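(* Let $0<\xi<1$ and let $(z,z')$ be in the principal or complementary series. The functions $\psi_a(x;z,z',\xi)$, where $a$ ranges over $\mathbb Z'$, are eigenfunctions of the difference operator $D(z,z',\xi)$ acting on functions of $x\in\mathbb Z'$: $$D(z,z',\xi)\,\psi_a(x;z,z',\xi)=a(1-\xi)\,\psi_a(x;z,z',\xi),\qquad x,a\in\mathbb Z'.$$
   Context: $\mathbb Z'=\mathbb Z+\frac12$. The pair $(z,z')$ is in the principal series if $z,z'$ are not real and are complex conjugate to each other; in the complementary series if $z,z'$ are both real and lie in the same open interval $(m,m+1)$ with $m\in\mathbb Z$. $F(A,B;C;w)$ is the Gauss hypergeometric function ${}_2F_1$ (continued to $w\in\mathbb C\setminus[1,\infty)$); $F(A,B;C;w)/\Gamma(C)$ is understood as its extension by continuity to all $C\in\mathbb C$. For $a,x\in\mathbb Z'$, $$\psi_a(x;z,z',\xi)=\left(\frac{\Gamma(x+z+\frac12)\Gamma(x+z'+\frac12)}{\Gamma(z-a+\frac12)\Gamma(z'-a+\frac12)}\right)^{\frac12}\xi^{\frac12(x+a)}(1-\xi)^{\frac12(z+z')-a}\,\frac{F(-z+a+\frac12,-z'+a+\frac12;x+a+1;\frac{\xi}{\xi-1})}{\Gamma(x+a+1)}.$$ The operator $D(z,z',\xi)$ acts on functions $f$ on $\mathbb Z'$ by $$D(z,z',\xi)f(x)=\sqrt{\xi(z+x+\tfrac12)(z'+x+\tfrac12)}\,f(x+1)+\sqrt{\xi(z+x-\tfrac12)(z'+x-\tfrac12)}\,f(x-1)-(x+\xi(z+z'+x))\,f(x).$$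 All quantities under square roots are positive, and positive roots are taken. *)

(* Defs.v *)
From Stdlib Require Import Reals ZArith ClassicalDescription.
From Coquelicot Require Import Coquelicot.
Local Open Scope C_scope.

Record half_int : Type := Half { hfloor : Z }.

Definition hval (x : half_int) : R := (IZR (hfloor x) + / 2)%R.
Coercion hval : half_int >-> R.

Definition hsucc (x : half_int) : half_int := Half (hfloor x + 1).
Definition hpred (x : half_int) : half_int := Half (hfloor x - 1).

Definition Ciota (P : C -> Prop) : C := iota (T := C_CompleteNormedModule) P.

Definition Cexp (s : C) : C :=
  ((exp (Re s) * cos (Im s))%R, (exp (Re s) * sin (Im s))%R).

(** [r ^ s] for a positive real base [r] and a complex exponent [s] *)
Definition Rcpow (r : R) (s : C) : C := Cexp (s * ln r).

(** Principal square root; on positive reals this is the positive root. *)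
Definition Csqrt (q : C) : C :=
  (sqrt ((Cmod q + Re q) / 2),
   if Rlt_dec (Im q) 0 then (- sqrt ((Cmod q - Re q) / 2))%R
   else sqrt ((Cmod q - Re q) / 2)).

Fixpoint pochhammer (s : C) (n : nat) : C :=
  match n with
  | O => 1
  | S m => pochhammer s m * (s + INR m)
  end.

(** Gauss' definition of the Gamma function,
      Gamma(s) = lim_n  n! n^s / (s (s+1) ... (s+n)),
    valid for every complex [s] other than 0, -1, -2, ... *)
Definition CGamma (s : C) : C :=
  Ciota (fun v : C =>
    filterlim
      (fun n : nat => INR (fact n) * Rcpow (INR n) s / pochhammer s (S n))
      eventually (locally v)).

Definition nonpos_int (s : C) : Prop := exists n : nat, s = - RtoC (INR n).

Definition hyp2F1_coef (A B c : C) (n : nat) : C :=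
  pochhammer A n * pochhammer B n / (pochhammer c n * INR (fact n)).

Definition cut_plane (w : C) : Prop := ~ (Im w = 0%R /\ (1 <= Re w)%R).

Definition analytic_on (U : C -> Prop) (f : C -> C) : Prop :=
  forall w : C, U w ->
  exists (coef : nat -> C) (r : R),
    (0 < r)%R /\
    forall u : C, (Cmod (u - w) < r)%R ->
      is_pseries (K := C_AbsRing) (V := C_NormedModule) coef (u - w) (f u).

Definition star_shaped (U : C -> Prop) : Prop :=
  forall (u : C) (t : R), U u -> (0 <= t <= 1)%R -> U (t * u).

(** [v] is the value at [w] of the analytic continuation of the Gauss series.
    The cut plane is star-shaped with respect to 0, so the continuation to it
    restricts to every smaller star-shaped domain [U] containing [w]; conversely
    the value at [w] does not depend on [U], since every [U] contains the
    segment from 0 to [w]. *)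
Definition is_hyp2F1 (A B c w v : C) : Prop :=
  exists (U : C -> Prop) (f : C -> C),
    open U /\ star_shaped U /\ (forall u, U u -> cut_plane u) /\ U w /\
    analytic_on U f /\
    (forall u : C, U u -> (Cmod u < 1)%R ->
      is_pseries (K := C_AbsRing) (V := C_NormedModule)
        (hyp2F1_coef A B c) u (f u)) /\
    f w = v.

(** Meaningful for [c] not in {0, -1, -2, ...} and [w] in the cut plane. *)
Definition hyp2F1 (A B c w : C) : C := Ciota (is_hyp2F1 A B c w).

Definition hyp2F1_over_Gamma (A B c w : C) : C :=
  if excluded_middle_informative (nonpos_int c) then
    Ciota (fun v : C =>
      filterlim (fun c' : C => hyp2F1 A B c' w / CGamma c')
        (locally' c) (locally v))
  else hyp2F1 A B c w / CGamma c.

Definition principal_series (z z' : C) : Prop :=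
  Im z <> 0%R /\ Im z' <> 0%R /\ z' = Cconj z.

Definition complementary_series (z z' : C) : Prop :=
  Im z = 0%R /\ Im z' = 0%R /\
  exists m : Z,
    (IZR m < Re z < IZR (m + 1))%R /\ (IZR m < Re z' < IZR (m + 1))%R.

Definition psi (z z' : C) (xi : R) (a x : half_int) : C :=
  Csqrt (CGamma (x + z + / 2) * CGamma (x + z' + / 2)
         / (CGamma (z - a + / 2) * CGamma (z' - a + / 2)))
  * Rcpow xi (/ 2 * (x + a))
  * Rcpow (1 - xi) (/ 2 * (z + z') - a)
  * hyp2F1_over_Gamma (- z + a + / 2) (- z' + a + / 2) (x + a + 1)
      (xi / (xi - 1)).

Definition D_op (z z' : C) (xi : R) (f : half_int -> C) (x : half_int) : C :=
  Csqrt (xi * (z + x + / 2) * (z' + x + / 2)) * f (hsucc x)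
  + Csqrt (xi * (z + x - / 2) * (z' + x - / 2)) * f (hpred x)
  - (x + xi * (z + z' + x)) * f x.

Definition eigenfunction (T : (half_int -> C) -> half_int -> C)
    (lambda : C) (f : half_int -> C) : Prop :=
  (exists x : half_int, f x <> 0) /\
  forall x : half_int, T f x = lambda * f x.

(* Main.v *)
Require Import Defs.
From Stdlib Require Import Reals ZArith Lra Lia ClassicalDescription.
From Coquelicot Require Import Coquelicot.
Local Open Scope C_scope.

(** Put [A = -z+a+1/2], [B = -z'+a+1/2] and [c = x+a+1], so that
    [c - A = x+z+1/2] and [c - B = x+z'+1/2].  As a function of [x], [psi] is a
    constant times [sqrt (Gamma(x+z+1/2) Gamma(x+z'+1/2)) xi^(x/2)] times
    [F(A,B;c;w) / Gamma(c)] with [w = xi/(xi-1)].  A unit step in [x] multiplies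
    the square root by [sqrt ((x+z+1/2)(x+z'+1/2))], which is the root that occurs
    in the operator.  All roots therefore disappear from the eigenvalue equation,
    and what remains is Gauss's relation between the contiguous functions at
    [c-1], [c] and [c+1] ([reg2F1_contiguous]).

    The point [w] may lie outside the unit disc, where [F] is only known through
    analytic continuation.  Pfaff's transformation
    [F(A,B;c;w) = (1-w)^(-A) F(A,c-B;c;w/(w-1))] brings it back inside: the
    argument on the right is [w/(w-1) = xi].  The map [u |-> u/(u-1)] sends the
    half plane [Re u < 1/2] into the unit disc, so the right-hand side is analytic
    there; it agrees with the Gauss series near 0 by the Chu-Vandermonde sum
    ([pfaff_local]), hence it is the continuation, which is unique by the identity
    theorem along rays ([identity_theorem], [is_hyp2F1_pfaff]).  The power
    [(1-w)^(-A)] is itself written as a binomial series in [w/(w-1)], so no branch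
    of a logarithm has to be chosen.

    When [c] is a nonpositive integer, the quotient by [Gamma(c)] is a limit.  The
    reciprocal of Gamma is constructed as an entire function from Gauss's product
    ([rGamma]), and [F(A,c-B;c;v) / Gamma(c)] becomes a series
    [reg2F1] whose terms are entire in [c].  It is continuous in [c], so
    [hyp2F1_over_Gamma] is given by the same formula for every [c]
    ([hyp2F1_over_Gamma_pfaff]).  In this form the contiguous relation holds
    coefficient by coefficient.  That [psi] does not vanish identically follows by
    letting [c] tend to infinity: [F(A,c-B;c;v)] tends to [(1-v)^(-A)]
    ([reg2F1_neq_0]).

    One analytic tool is used throughout, Tannery's theorem ([tannery]): it gives
    the exchange of double sums, Cauchy products and composition of power series,
    and the continuity in parameters of the infinite products and series. *)


(** * Series of complex numbers and dominated convergence *)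

Notation Cseries := (@is_series C_AbsRing C_NormedModule).

(** Limits in [C] are defined by the uniform structure of pairs of reals; all
    estimates below are in terms of the modulus. *)
Lemma Clim_eps {T} (F : (T -> Prop) -> Prop) {FF : Filter F} (f : T -> C) (l : C) :
  filterlim f F (locally l) <->
  forall eps : R, (0 < eps)%R -> F (fun x => (Cmod (f x - l) < eps)%R).
Proof.
  split.
  - intros H eps Heps.
    exact (proj1 (@filterlim_locally_ball_norm C_AbsRing T C_NormedModule F FF f l)
      H (mkposreal eps Heps)).
  - intros H.
    apply (proj2 (@filterlim_locally_ball_norm C_AbsRing T C_NormedModule F FF f l)).
    intros [eps Heps]; exact (H eps Heps).
Qed.

Lemma Clocally_eps (x : C) (P : C -> Prop) :
  locally x P <-> exists eps : R, (0 < eps)%R /\ forall y, (Cmod (y - x) < eps)%R -> P y.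
Proof.
  split.
  - intros H. destruct (@locally_norm_le_locally C_AbsRing C_NormedModule x P H) as [e He].
    exists e; split; [apply cond_pos|]. intros y Hy; apply He; exact Hy.
  - intros [e [He H]].
    apply (@locally_le_locally_norm C_AbsRing C_NormedModule x P).
    exists (mkposreal e He). intros y Hy; apply H; exact Hy.
Qed.

Lemma Cseries_unique (a : nat -> C) (l l' : C) : Cseries a l -> Cseries a l' -> l = l'.
Proof.
  exact (@filterlim_locally_unique nat C_AbsRing C_NormedModule eventually _ _ l l').
Qed.

Lemma Cseries_ext (a b : nat -> C) (l : C) : (forall n, a n = b n) -> Cseries a l -> Cseries b l.
Proof. apply is_series_ext. Qed.

Lemma Cseries_plus (a b : nat -> C) (la lb : C) : Cseries a la -> Cseries b lb ->
  Cseries (fun n => a n + b n) (la + lb).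
Proof. exact (is_series_plus (V := C_NormedModule) a b la lb). Qed.

Lemma Cseries_scal (c : C) (a : nat -> C) (la : C) : Cseries a la -> Cseries (fun n => c * a n) (c * la).
Proof. exact (is_series_scal_l (V := C_NormedModule) c a la). Qed.

Lemma Cseries_minus (a b : nat -> C) (la lb : C) : Cseries a la -> Cseries b lb ->
  Cseries (fun n => a n - b n) (la - lb).
Proof. exact (is_series_minus (V := C_NormedModule) a b la lb). Qed.

(** Partial sums, as elements of the field [C] rather than of its underlying
    additive monoid. *)
Definition Csum_n (a : nat -> C) (n : nat) : C := @sum_n C_AbelianMonoid a n.

Lemma Cseries_def (a : nat -> C) (l : C) : Cseries a l <-> filterlim (Csum_n a) eventually (locally l).
Proof. reflexivity. Qed.

Lemma Csum_S (a : nat -> C) n : Csum_n a (S n) = Csum_n a n + a (S n).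
Proof. exact (sum_Sn (G := C_AbelianMonoid) a n). Qed.

Lemma Rsum_S (a : nat -> R) n : (sum_n a (S n) = sum_n a n + a (S n))%R.
Proof. exact (sum_Sn a n). Qed.

Lemma Csum_0 (a : nat -> C) : Csum_n a 0 = a 0%nat.
Proof. exact (sum_O (G := C_AbelianMonoid) a). Qed.

Lemma Csum_ext (a b : nat -> C) n : (forall k, (k <= n)%nat -> a k = b k) -> Csum_n a n = Csum_n b n.
Proof. exact (sum_n_ext_loc (G := C_AbelianMonoid) a b n). Qed.

Lemma Csum_plus (a b : nat -> C) n :
  Csum_n (fun k => a k + b k) n = Csum_n a n + Csum_n b n.
Proof. exact (sum_n_plus (G := C_AbelianMonoid) a b n). Qed.

Lemma Csum_scal c (a : nat -> C) n :
  Csum_n (fun k => c * a k) n = c * Csum_n a n.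
Proof.
  exact (sum_n_mult_l (K := C_Ring) c a n).
Qed.

Lemma Csum_norm (a : nat -> C) n :
  (Cmod (Csum_n a n) <= sum_n (fun k => Cmod (a k)) n)%R.
Proof.
  induction n.
  - rewrite Csum_0, sum_O. lra.
  - rewrite Csum_S, Rsum_S. eapply Rle_trans; [apply Cmod_triangle|]. lra.
Qed.

Lemma Cseries_finite (a : nat -> C) N :
  (forall n, (N < n)%nat -> a n = 0) -> Cseries a (Csum_n a N).
Proof.
  intros H. apply Cseries_def, Clim_eps; [apply eventually_filter|]. intros eps Heps. exists N. intros n Hn.
  replace (Csum_n a n) with (Csum_n a N).
  - replace (_ - _) with (RtoC 0) by ring. rewrite Cmod_0; exact Heps.
  - induction Hn; [reflexivity|]. rewrite Csum_S, <- IHHn, H by lia. ring.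
Qed.

Lemma Cmod_lim_le {T} (F : (T -> Prop) -> Prop) {FF : ProperFilter F} (f : T -> C) l c b :
  filterlim f F (locally l) -> F (fun x => (Cmod (f x - c) <= b)%R) -> (Cmod (l - c) <= b)%R.
Proof.
  intros H1 H2. apply Rnot_lt_le. intros H.
  rewrite Clim_eps in H1 by apply FF.
  assert (He : (0 < Cmod (l - c) - b)%R) by lra.
  destruct (filter_ex _ (filter_and _ _ (H1 _ He) H2)) as [x [A B]].
  assert (Cmod (l - c) <= Cmod (f x - l) + Cmod (f x - c))%R; [|lra].
  replace (l - c) with ((- (f x - l)) + (f x - c)) by ring.
  rewrite <- (Cmod_opp (f x - l)). apply Cmod_triangle.
Qed.

Lemma ex_series_bounded_tail (M : nat -> R) :
  ex_series M -> forall eps, (0 < eps)%R -> exists N, forall n, (N <= n)%nat ->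
  (Rabs (Series M - sum_n M n) < eps)%R.
Proof.
  intros H eps Heps. pose proof (Series_correct M H) as HM.
  pose proof (proj1 (filterlim_locally _ _) HM (mkposreal eps Heps)) as [N HN].
  exists N; intros n Hn. specialize (HN n Hn).
  rewrite Rabs_minus_sym. exact HN.
Qed.

(** The bound passes from the partial sums, for which it is the triangle
    inequality, to their limit. *)
Lemma Cseries_tail (a : nat -> C) (M : nat -> R) (l : C) N :
  Cseries a l -> (forall n, (N < n)%nat -> (Cmod (a n) <= M n)%R) -> ex_series M ->
  (Cmod (l - Csum_n a N) <= Series M - sum_n M N)%R.
Proof.
  intros Ha HM HS.
  apply (Cmod_lim_le eventually (Csum_n a)); [exact Ha|].
  exists N. intros n Hn.
  assert (A : (Cmod (Csum_n a n - Csum_n a N) <= sum_n M n - sum_n M N)%R).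
  { induction Hn.
    - replace (_ - _)%C with (RtoC 0) by ring. rewrite Cmod_0; lra.
    - rewrite Csum_S, Rsum_S.
      replace (Csum_n a m + a (S m) - Csum_n a N) with ((Csum_n a m - Csum_n a N) + a (S m)) by ring.
      eapply Rle_trans; [apply Cmod_triangle|].
      specialize (HM (S m) ltac:(lia)). lra. }
  eapply Rle_trans; [exact A|].
  assert (B : (sum_n M n <= Series M)%R); [|lra].
  apply Rnot_lt_le; intros C0.
  destruct (ex_series_bounded_tail M HS (sum_n M n - Series M) ltac:(lra)) as [N1 HN1].
  assert (D : forall m, (n <= m)%nat -> (sum_n M n <= sum_n M m)%R).
  { intros m Hm; induction Hm; [lra|]. rewrite Rsum_S.
    pose proof (HM (S m) ltac:(lia)). pose proof (Cmod_ge_0 (a (S m))). lra. }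
  specialize (HN1 (max N1 n) ltac:(lia)). specialize (D (max N1 n) ltac:(lia)).
  apply Rabs_lt_between in HN1. lra.
Qed.

Lemma Csum_filterlim {T} (F : (T -> Prop) -> Prop) {FF : Filter F} (t : T -> nat -> C) (l : nat -> C) N :
  (forall n, filterlim (fun x => t x n) F (locally (l n))) ->
  filterlim (fun x => Csum_n (t x) N) F (locally (Csum_n l N)).
Proof.
  intros H. induction N.
  - eapply filterlim_ext; [|rewrite Csum_0; apply (H 0%nat)].
    intros x; simpl; now rewrite Csum_0.
  - rewrite Csum_S.
    eapply filterlim_ext; [intros x; symmetry; apply Csum_S|].
    refine (filterlim_comp_2 _ _ Cplus IHN (H (S N)) _).
    exact (filterlim_plus (V := C_NormedModule) (Csum_n l N) (l (S N))).
Qed.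

(** Tannery's theorem.  Cut both sums at an index beyond which the tail of the
    majorant is small; the finitely many remaining terms converge one by one.  The
    domination is asked only from the index [N] on, because the majorants used for
    Gamma and for [F/Gamma] are uniform in the parameter only for large indices. *)
Lemma tannery {T} (F : (T -> Prop) -> Prop) {FF : ProperFilter F}
  (t : T -> nat -> C) (s : T -> C) (l : nat -> C) (L : C) (M : nat -> R) (N : nat) :
  (forall n, filterlim (fun x => t x n) F (locally (l n))) ->
  ex_series M ->
  F (fun x => forall n, (N <= n)%nat -> (Cmod (t x n) <= M n)%R) ->
  F (fun x => Cseries (t x) (s x)) ->
  Cseries l L ->
  filterlim s F (locally L).
Proof.
  intros Hl HM Hdom Hs HL.
  assert (HlM : forall n, (N <= n)%nat -> (Cmod (l n) <= M n)%R).
  { intros n Hn. replace (l n) with (l n - 0) by ring.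
    apply (Cmod_lim_le F (fun x => t x n)); [apply Hl|].
    revert Hdom. apply filter_imp. intros x Hx.
    replace (t x n - 0) with (t x n) by ring. auto. }
  apply Clim_eps; [apply FF|]. intros eps Heps.
  destruct (ex_series_bounded_tail M HM (eps / 3) ltac:(lra)) as [N1 HN1].
  pose (K := max N N1).
  specialize (HN1 K ltac:(lia)).
  pose proof (Csum_filterlim F t l K Hl) as HK.
  rewrite Clim_eps in HK by apply FF. specialize (HK (eps / 3)%R ltac:(lra)).
  generalize (filter_and _ _ HK (filter_and _ _ Hdom Hs)).
  apply filter_imp. intros x [H1 [H2 H3]].
  pose proof (Cseries_tail (t x) M (s x) K H3 ltac:(intros; apply H2; lia) HM) as T1.
  pose proof (Cseries_tail l M L K HL ltac:(intros; apply HlM; lia) HM) as T2.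
  apply Rabs_lt_between in HN1.
  replace (s x - L) with ((s x - Csum_n (t x) K) + ((Csum_n (t x) K - Csum_n l K) + - (L - Csum_n l K))) by ring.
  eapply Rle_lt_trans; [apply Cmod_triangle|].
  eapply Rle_lt_trans; [apply Rplus_le_compat_l, Cmod_triangle|].
  rewrite Cmod_opp. lra.
Qed.

(** The sum as a total function; meaningful for convergent series. *)
Definition CSum (a : nat -> C) : C := Ciota (fun l => Cseries a l).

Lemma Ciota_unique (P : C -> Prop) x : (forall y, P y -> y = x) -> P x -> Ciota P = x.
Proof. exact (iota_unique (V := C_CompleteNormedModule) P x). Qed.

Lemma CSum_unique (a : nat -> C) (l : C) : Cseries a l -> CSum a = l.
Proof.
  intros H. apply Ciota_unique; [|exact H]. intros y Hy. exact (Cseries_unique a y l Hy H).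
Qed.

Lemma CSum_dominated_from (a : nat -> C) (M : nat -> R) N :
  (forall n, (N <= n)%nat -> (Cmod (a n) <= M n)%R) -> ex_series M -> Cseries a (CSum a).
Proof.
  intros H1 H2.
  assert (E : @ex_series C_AbsRing C_NormedModule a).
  { apply (proj2 (ex_series_incr_n (V := C_NormedModule) a N)).
    apply (@ex_series_le C_AbsRing C_CompleteNormedModule (fun k => a (N + k)%nat) (fun k => M (N + k)%nat)).
    - intros n. apply H1. lia.
    - apply (proj1 (ex_series_incr_n (V := R_NormedModule) M N)). exact H2. }
  destruct E as [l Hl]. rewrite (CSum_unique a l); exact Hl.
Qed.

Lemma CSum_dominated (a : nat -> C) (M : nat -> R) :
  (forall n, (Cmod (a n) <= M n)%R) -> ex_series M -> Cseries a (CSum a).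
Proof. intros H. apply (CSum_dominated_from a M 0). intros n _. apply H. Qed.

Lemma CSum_abs (a : nat -> C) : ex_series (fun n => Cmod (a n)) -> Cseries a (CSum a).
Proof. apply CSum_dominated. intros; apply Rle_refl. Qed.

Lemma sum_n_ge_term (a : nat -> R) k : (forall n, 0 <= a n)%R -> (a k <= sum_n a k)%R.
Proof.
  intros H. assert (forall n, 0 <= sum_n a n)%R.
  { induction n; [rewrite sum_O; apply H|]. rewrite Rsum_S. specialize (H (S n)). lra. }
  destruct k; [rewrite sum_O; lra|]. rewrite Rsum_S. specialize (H0 k). lra.
Qed.

(** A partial sum of the column sums is the sum over all rows of the truncated
    rows, so the exchange is [tannery] for growing truncation. *)
Lemma fubini (a : nat -> nat -> C) (row col : nat -> C) (S0 : C) (M : nat -> R) :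
  (forall n K, (sum_n (fun k => Cmod (a n k)) K <= M n)%R) -> ex_series M ->
  (forall n, Cseries (a n) (row n)) -> Cseries row S0 ->
  (forall k, Cseries (fun n => a n k) (col k)) ->
  Cseries col S0.
Proof.
  intros H1 HM Hr HS Hc.
  apply (tannery eventually (fun K n => Csum_n (a n) K) (Csum_n col) row S0 M 0).
  - intros n. exact (Hr n).
  - exact HM.
  - exists 0%nat. intros K _ n _. eapply Rle_trans; [apply Csum_norm|apply H1].
  - exists 0%nat. intros K _. induction K.
    + rewrite Csum_0. eapply Cseries_ext; [|apply Hc]. intros n; simpl; now rewrite Csum_0.
    + rewrite Csum_S. eapply Cseries_ext; [|apply (Cseries_plus _ _ _ _ IHK (Hc (S K)))].
      intros n; simpl; now rewrite Csum_S.
  - exact HS.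
Qed.

Lemma ex_series_pos_bounded (a : nat -> R) B :
  (forall n, 0 <= a n)%R -> (forall K, sum_n a K <= B)%R -> ex_series a.
Proof.
  intros H1 H2.
  destruct (ex_finite_lim_seq_incr (sum_n a) B) as [l Hl].
  - intros n. rewrite Rsum_S. specialize (H1 (S n)). lra.
  - exact H2.
  - exists l. exact Hl.
Qed.

Lemma sum_n_le_Series (a : nat -> R) K :
  (forall n, 0 <= a n)%R -> ex_series a -> (sum_n a K <= Series a)%R.
Proof.
  intros H1 H2.
  assert (H := Cseries_tail (fun _ => RtoC 0) a (RtoC 0) K).
  assert (Z : Csum_n (fun _ : nat => RtoC 0) K = 0).
  { clear; induction K; [now rewrite Csum_0|]. rewrite Csum_S, IHK. ring. }
  rewrite Z in H.
  assert (A : Cseries (fun _ : nat => RtoC 0) (RtoC 0)).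
  { pose proof (Cseries_finite (fun _ => RtoC 0) 0 ltac:(auto)) as B. rewrite Csum_0 in B. exact B. }
  specialize (H A). replace (0 - 0) with (RtoC 0) in H by ring. rewrite Cmod_0 in H.
  assert (0 <= Series a - sum_n a K)%R; [|lra]. apply H; [|exact H2].
  intros; apply H1.
Qed.

(** * Power series and analytic functions *)

Lemma geom_bound (a : nat -> R) q N : (0 < q)%R -> (forall n, 0 <= a n)%R ->
  (forall n, (N <= n)%nat -> (a (S n) <= q * a n)%R) ->
  exists K, (0 <= K)%R /\ forall n, (a n <= K * q ^ n)%R.
Proof.
  intros Hq Ha H.
  assert (P : forall n, (0 <= a n / q ^ n)%R).
  { intros n. apply Rmult_le_pos; [apply Ha|]. left; apply Rinv_0_lt_compat, pow_lt, Hq. }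
  exists (sum_n (fun n => a n / q ^ n)%R N). split.
  - eapply Rle_trans; [apply (P N)|]. exact (sum_n_ge_term _ N P).
  - intros n. destruct (Nat.le_gt_cases n N) as [L|L].
    + apply (Rmult_le_reg_r (/ q ^ n)); [apply Rinv_0_lt_compat, pow_lt, Hq|].
      rewrite Rmult_assoc, Rinv_r, Rmult_1_r by (apply pow_nonzero; lra).
      clear H. induction L.
      * exact (sum_n_ge_term _ n P).
      * rewrite Rsum_S. specialize (P (S m)). cbv beta. unfold Rdiv in IHL, P |- *. lra.
    + assert (L' : (N <= n)%nat) by lia. clear L. induction L'.
      * apply (Rmult_le_reg_r (/ q ^ N)); [apply Rinv_0_lt_compat, pow_lt, Hq|].
        rewrite Rmult_assoc, Rinv_r, Rmult_1_r by (apply pow_nonzero; lra).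
        exact (sum_n_ge_term _ N P).
      * eapply Rle_trans; [apply H; exact L'|].
        apply (Rmult_le_compat_l q) in IHL'; [|lra]. simpl. lra.
Qed.

Lemma ex_series_Rle (a b : nat -> R) :
  (forall n, 0 <= a n <= b n)%R -> ex_series b -> ex_series a.
Proof.
  intros H Hb. apply (@ex_series_le R_AbsRing R_CompleteNormedModule a b); [|exact Hb].
  intros n. specialize (H n). change (Rabs (a n) <= b n)%R. rewrite Rabs_pos_eq; lra.
Qed.

Lemma ex_series_geom_scal K q : (0 <= q < 1)%R -> ex_series (fun n => K * q ^ n)%R.
Proof.
  intros H. apply (ex_series_scal_l K (fun n => q ^ n)%R). apply ex_series_geom.
  rewrite Rabs_pos_eq; lra.
Qed.

(** Coefficients of [X^n * b(X)]. *)
Fixpoint shift (b : nat -> C) (n k : nat) : C :=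
  match n, k with
  | O, _ => b k
  | S n', O => 0
  | S n', S k' => shift b n' k'
  end.

Lemma shift_ge b n : forall k, (n <= k)%nat -> shift b n k = b (k - n)%nat.
Proof.
  induction n; intros k H; simpl.
  - now rewrite Nat.sub_0_r.
  - destruct k; [lia|]. simpl. apply IHn. lia.
Qed.

Lemma shift_lt b n : forall k, (k < n)%nat -> shift b n k = 0.
Proof.
  induction n; intros k H; simpl; [lia|]. destruct k; [reflexivity|]. apply IHn. lia.
Qed.

Lemma Cseries_cons (a : nat -> C) (l : C) :
  Cseries (fun k => a (S k)) (l - a 0%nat) -> Cseries a l.
Proof. exact (is_series_decr_1 (V := C_NormedModule) a l). Qed.

Lemma Cseries_shift (b : nat -> C) (l : C) n : Cseries b l -> Cseries (shift b n) l.
Proof.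
  intros H. induction n.
  - exact H.
  - apply Cseries_cons. simpl.
    replace (l - 0) with l by ring. exact IHn.
Qed.

Lemma Rsum_first (a : nat -> R) K : (sum_n a (S K) = a 0%nat + sum_n (fun k => a (S k)) K :> R)%R.
Proof.
  induction K.
  - now rewrite Rsum_S, !sum_O.
  - rewrite Rsum_S, IHK, Rsum_S. ring.
Qed.

Lemma Csum_first (a : nat -> C) K : Csum_n a (S K) = a 0%nat + Csum_n (fun k => a (S k)) K.
Proof.
  induction K.
  - now rewrite Csum_S, !Csum_0.
  - rewrite Csum_S, IHK, Csum_S. ring.
Qed.

Lemma shift_sum_bound (b : nat -> C) n B : (0 <= B)%R ->
  (forall J, sum_n (fun k => Cmod (b k)) J <= B)%R ->
  forall K, (sum_n (fun k => Cmod (shift b n k)) K <= B)%R.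
Proof.
  intros HB H. induction n; intros K; [apply H|].
  destruct K.
  - rewrite sum_O. simpl. rewrite Cmod_0. exact HB.
  - rewrite Rsum_first. simpl. rewrite Cmod_0. specialize (IHn K). lra.
Qed.

Lemma shift_sum_le (b : nat -> C) n : ex_series (fun k => Cmod (b k)) ->
  forall K, (sum_n (fun k => Cmod (shift b n k)) K <= Series (fun k => Cmod (b k)))%R.
Proof.
  intros H. assert (P : forall K, (sum_n (fun k => Cmod (b k)) K <= Series (fun k => Cmod (b k)))%R).
  { intros K. apply (sum_n_le_Series (fun k => Cmod (b k))); [intros; apply Cmod_ge_0|exact H]. }
  apply shift_sum_bound; [|exact P].
  eapply Rle_trans; [|apply (P 0%nat)]. rewrite sum_O. apply Cmod_ge_0.
Qed.

Definition conv (a b : nat -> C) (k : nat) : C := Csum_n (fun i => a i * b (k - i)%nat) k.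

Lemma Series_scal_r_abs (a : nat -> C) B : ex_series (fun n => Cmod (a n)) ->
  ex_series (fun n => Cmod (a n) * B)%R.
Proof. intros H. exact (ex_series_scal_r B _ H). Qed.

(** The rows of the array [a n * (X^n b) k] sum to [a n * B], its columns are
    finite sums, the coefficients of the product. *)
Lemma cauchy_product (a b : nat -> C) (A B : C) :
  ex_series (fun n => Cmod (a n)) -> ex_series (fun n => Cmod (b n)) ->
  Cseries a A -> Cseries b B -> Cseries (conv a b) (A * B).
Proof.
  intros Ha Hb HA HB.
  apply (fubini (fun n k => a n * shift b n k) (fun n => a n * B) (conv a b) (A * B)
    (fun n => Cmod (a n) * Series (fun k => Cmod (b k)))%R).
  - intros n K. pose proof (shift_sum_le b n Hb K).
    apply (Rmult_le_compat_l (Cmod (a n))) in H; [|apply Cmod_ge_0].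
    eapply Rle_trans; [|exact H]. right.
    clear. induction K; [rewrite !sum_O; apply Cmod_mult|].
    rewrite !Rsum_S, IHK, Cmod_mult. ring.
  - now apply Series_scal_r_abs.
  - intros n. apply Cseries_scal. now apply Cseries_shift.
  - apply (Cseries_ext (fun n => B * a n)); [intros; ring|].
    replace (A * B) with (B * A) by ring. now apply Cseries_scal.
  - intros k. unfold conv.
    rewrite (Csum_ext _ (fun n => a n * shift b n k)).
    + apply (Cseries_finite (fun n => a n * shift b n k)). intros n Hn. rewrite shift_lt by lia. ring.
    + intros i Hi. now rewrite shift_ge.
Qed.

Lemma cauchy_product_abs (a b : nat -> C) :
  ex_series (fun n => Cmod (a n)) -> ex_series (fun n => Cmod (b n)) ->
  ex_series (fun n => Cmod (conv a b n)) /\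
  (Series (fun n => Cmod (conv a b n)) <= Series (fun n => Cmod (a n)) * Series (fun n => Cmod (b n)))%R.
Proof.
  intros Ha Hb.
  pose proof (is_series_mult_pos _ _ _ _ (Series_correct _ Ha) (Series_correct _ Hb)
    (fun n => Cmod_ge_0 (a n)) (fun n => Cmod_ge_0 (b n))) as H.
  assert (Hle : forall n, (0 <= Cmod (conv a b n) <=
     sum_f_R0 (fun k => Cmod (a k) * Cmod (b (n - k)%nat)) n)%R).
  { intros n. split; [apply Cmod_ge_0|]. unfold conv.
    eapply Rle_trans; [apply Csum_norm|]. rewrite sum_n_Reals. right.
    apply sum_eq. intros i _. apply Cmod_mult. }
  split.
  - eapply ex_series_Rle; [exact Hle|]. eexists; exact H.
  - rewrite <- (is_series_unique _ _ H). apply Series_le; [exact Hle|]. eexists; exact H.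
Qed.

(** Absolute convergence on the closed disc is part of the notion, so that
    products and powers keep the radius. *)
Definition expands (f : C -> C) (w : C) (c : nat -> C) (r : R) : Prop :=
  (0 < r)%R /\ ex_series (fun k => Cmod (c k) * r ^ k)%R /\
  forall d, (Cmod d <= r)%R -> Cseries (fun k => c k * d ^ k) (f (w + d)).

(** The weighted l1 norm, submultiplicative for [conv]: the majorant that makes
    composition of power series work. *)
Definition wnorm (c : nat -> C) (r : R) : R := Series (fun k => Cmod (c k) * r ^ k)%R.

Lemma wnorm_ge_0 (c : nat -> C) r : (0 <= r)%R -> ex_series (fun k => Cmod (c k) * r ^ k)%R ->
  (0 <= wnorm c r)%R.
Proof.
  intros Hr Hc.
  assert (P : forall k, (0 <= Cmod (c k) * r ^ k)%R).
  { intros k. apply Rmult_le_pos; [apply Cmod_ge_0|now apply pow_le]. }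
  eapply Rle_trans; [apply (P 0%nat)|].
  pose proof (sum_n_le_Series (fun k => Cmod (c k) * r ^ k)%R 0 P Hc) as Q.
  rewrite sum_O in Q. exact Q.
Qed.

Lemma Cmod_coef (c : nat -> C) (d : C) k : (Cmod (c k * d ^ k) = Cmod (c k) * Cmod d ^ k)%R.
Proof. now rewrite Cmod_mult, Cmod_pow. Qed.

Lemma is_pseries_C (c : nat -> C) (d l : C) :
  @is_pseries C_AbsRing C_NormedModule c d l <-> Cseries (fun k => c k * d ^ k) l.
Proof.
  assert (E : forall k, scal (pow_n (K := C_AbsRing) d k) (c k) = c k * d ^ k).
  { intros k. change (Cmult (pow_n (K := C_AbsRing) d k) (c k) = c k * d ^ k).
    rewrite Cmult_comm. reflexivity. }
  split; apply is_series_ext; intros k; rewrite <- E; reflexivity.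
Qed.

Lemma Cseries_bounded_terms (a : nat -> C) (l : C) : Cseries a l ->
  exists K, forall n, (Cmod (a n) <= K)%R.
Proof.
  intros H0. pose proof (proj1 (Clim_eps eventually (Csum_n a) l) H0) as H.
  destruct (H 1%R Rlt_0_1) as [N HN].
  exists (2 + sum_n (fun k => Cmod (a k)) N)%R. intros n.
  assert (P : forall k, (0 <= Cmod (a k))%R) by (intros; apply Cmod_ge_0).
  destruct (Nat.le_gt_cases n N) as [L|L].
  - enough (Cmod (a n) <= sum_n (fun k => Cmod (a k)) N)%R by lra.
    clear HN H H0. induction L; [exact (sum_n_ge_term (fun k => Cmod (a k)) n P)|].
    rewrite Rsum_S. specialize (P (S m)). lra.
  - destruct n; [lia|].
    pose proof (HN n ltac:(lia)) as H1. pose proof (HN (S n) ltac:(lia)) as H2.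
    rewrite Csum_S in H2.
    assert (Cmod (a (S n)) <= Cmod (Csum_n a n + a (S n) - l) + Cmod (Csum_n a n - l))%R.
    { rewrite <- (Cmod_opp (Csum_n a n - l)).
      replace (a (S n)) with ((Csum_n a n + a (S n) - l) + - (Csum_n a n - l)) at 1 by ring.
      apply Cmod_triangle. }
    pose proof (sum_n_ge_term (fun k => Cmod (a k)) N P). specialize (P N). lra.
Qed.

(** The terms at radius [s], between [r'] and [r], are bounded, so those at radius
    [r'] are dominated by a geometric series of ratio [r'/s]. *)
Lemma expands_intro f w c r r' : (0 < r' < r)%R ->
  (forall d, (Cmod d < r)%R -> Cseries (fun k => c k * d ^ k) (f (w + d))) ->
  expands f w c r'.
Proof.
  intros Hr H. split; [lra|]. split; [|intros d Hd; apply H; lra].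
  set (s := ((r' + r) / 2)%R).
  destruct (Cseries_bounded_terms _ _ (H (RtoC s) ltac:(rewrite Cmod_R, Rabs_pos_eq; unfold s; lra)))
    as [K HK].
  assert (Hs : (0 < s)%R) by (unfold s; lra).
  apply (ex_series_Rle _ (fun k => K * (r' / s) ^ k)%R).
  - intros n. split.
    + apply Rmult_le_pos; [apply Cmod_ge_0|apply pow_le; lra].
    + specialize (HK n). rewrite Cmod_coef, Cmod_R, Rabs_pos_eq in HK by lra.
      unfold Rdiv. rewrite Rpow_mult_distr, pow_inv.
      apply (Rmult_le_compat_r (r' ^ n * / s ^ n)) in HK.
      * replace (Cmod (c n) * r' ^ n)%R with (Cmod (c n) * s ^ n * (r' ^ n * / s ^ n))%R; [exact HK|].
        field. apply pow_nonzero; lra.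
      * apply Rmult_le_pos; [apply pow_le; lra|]. left; apply Rinv_0_lt_compat, pow_lt, Hs.
  - apply ex_series_geom_scal. split.
    + apply Rmult_le_pos; [lra|]. left; apply Rinv_0_lt_compat, Hs.
    + apply Rlt_div_l; unfold s; lra.
Qed.

Lemma ex_wseries_le c r r' : (0 <= r' <= r)%R -> ex_series (fun k => Cmod (c k) * r ^ k)%R ->
  ex_series (fun k => Cmod (c k) * r' ^ k)%R.
Proof.
  intros H. apply ex_series_Rle. intros n. split.
  - apply Rmult_le_pos; [apply Cmod_ge_0|apply pow_le; lra].
  - apply Rmult_le_compat_l; [apply Cmod_ge_0|]. apply pow_incr; lra.
Qed.

Lemma expands_le f w c r r' : (0 < r' <= r)%R -> expands f w c r -> expands f w c r'.
Proof.
  intros H [H1 [H2 H3]]. split; [lra|]. split.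
  - apply (ex_wseries_le c r r'); [lra|exact H2].
  - intros d Hd. apply H3; lra.
Qed.

Lemma expands_ext f g w c r : (forall u, f u = g u) -> expands f w c r -> expands g w c r.
Proof.
  intros E [H1 [H2 H3]]. split; [exact H1|]. split; [exact H2|].
  intros d Hd. rewrite <- E. now apply H3.
Qed.

Lemma expands_minus f g w a b r : expands f w a r -> expands g w b r ->
  expands (fun u => f u - g u) w (fun k => a k - b k) r.
Proof.
  intros [H1 [H2 H3]] [G1 [G2 G3]]. split; [exact H1|]. split.
  - apply (ex_series_Rle _ (fun k => Cmod (a k) * r ^ k + Cmod (b k) * r ^ k)%R).
    + intros n. split; [apply Rmult_le_pos; [apply Cmod_ge_0|apply pow_le; lra]|].
      rewrite <- Rmult_plus_distr_r. apply Rmult_le_compat_r; [apply pow_le; lra|].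
      rewrite <- (Cmod_opp (b n)). apply Cmod_triangle.
    + exact (ex_series_plus (V := R_NormedModule) _ _ H2 G2).
  - intros d Hd. apply (Cseries_ext (fun k => a k * d ^ k - b k * d ^ k)); [intros; ring|].
    apply Cseries_minus; auto.
Qed.

Lemma conv_weight a b d k : conv (fun i => a i * d ^ i) (fun i => b i * d ^ i) k = conv a b k * d ^ k.
Proof.
  unfold conv. rewrite (Cmult_comm _ (d ^ k)), <- Csum_scal. apply Csum_ext. intros i Hi.
  replace (d ^ k) with (d ^ i * d ^ (k - i)) by (rewrite <- Cpow_add_r; f_equal; lia). ring.
Qed.

Lemma ex_weight (c : nat -> C) d r : (Cmod d <= r)%R -> ex_series (fun k => Cmod (c k) * r ^ k)%R ->
  ex_series (fun k => Cmod (c k * d ^ k)).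
Proof.
  intros H Hc. eapply ex_series_ext; [intros k; symmetry; apply Cmod_coef|].
  apply (ex_wseries_le c r); [|exact Hc]. split; [apply Cmod_ge_0|exact H].
Qed.

Lemma wnorm_conv a b r : (0 < r)%R ->
  ex_series (fun k => Cmod (a k) * r ^ k)%R -> ex_series (fun k => Cmod (b k) * r ^ k)%R ->
  ex_series (fun k => Cmod (conv a b k) * r ^ k)%R /\ (wnorm (conv a b) r <= wnorm a r * wnorm b r)%R.
Proof.
  intros Hr Ha Hb.
  assert (E : forall c k, (Cmod (c k * (RtoC r) ^ k) = Cmod (c k) * r ^ k)%R).
  { intros c k. rewrite Cmod_coef, Cmod_R, Rabs_pos_eq by lra. reflexivity. }
  assert (Hm : (Cmod (RtoC r) <= r)%R) by (rewrite Cmod_R, Rabs_pos_eq; lra).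
  destruct (cauchy_product_abs _ _ (ex_weight a _ r Hm Ha) (ex_weight b _ r Hm Hb)) as [P Q].
  assert (E' : forall k, Cmod (conv (fun i => a i * (RtoC r) ^ i) (fun i => b i * (RtoC r) ^ i) k) =
     (Cmod (conv a b k) * r ^ k)%R).
  { intros k. now rewrite conv_weight, E. }
  split.
  - eapply ex_series_ext; [|exact P]. exact E'.
  - unfold wnorm. rewrite <- (Series_ext _ _ E'), <- (Series_ext _ _ (E a)), <- (Series_ext _ _ (E b)).
    exact Q.
Qed.

Lemma expands_mult f g w a b r : expands f w a r -> expands g w b r ->
  expands (fun u => f u * g u) w (conv a b) r.
Proof.
  intros [H1 [H2 H3]] [G1 [G2 G3]]. split; [exact H1|]. split.
  - now apply wnorm_conv.
  - intros d Hd. apply (Cseries_ext _ _ _ (conv_weight a b d)).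
    apply cauchy_product; auto; eapply ex_weight; eauto.
Qed.

Fixpoint convpow (c : nat -> C) (n : nat) : nat -> C :=
  match n with
  | O => fun k => match k with O => 1 | S _ => 0 end
  | S n' => conv c (convpow c n')
  end.

Lemma Cseries_single (a : nat -> C) : (forall n, (0 < n)%nat -> a n = 0) -> Cseries a (a 0%nat).
Proof.
  intros H. pose proof (Cseries_finite a 0 H) as E. now rewrite Csum_0 in E.
Qed.

Lemma is_series_single (a : nat -> R) : (forall n, a (S n) = 0%R) -> is_series a (a 0%nat).
Proof.
  intros H. apply is_series_decr_1.
  apply (is_series_ext (fun _ => 0%R)); [intros; now rewrite H|].
  change (is_series (fun _ : nat => 0%R) (a 0%nat + - a 0%nat)%R). rewrite Rplus_opp_r.
  apply is_series_Reals. intros e He. exists 0%nat. intros n _.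
  rewrite sum_eq_R0 by auto. unfold Rdist, Rminus. rewrite Rplus_opp_r, Rabs_R0. exact He.
Qed.

Lemma expands_pow f w c r n : expands f w c r ->
  expands (fun u => f u ^ n) w (convpow c n) r /\ (wnorm (convpow c n) r <= wnorm c r ^ n)%R.
Proof.
  intros H. induction n.
  - assert (E : is_series (fun k => (Cmod (convpow c 0 k) * r ^ k)%R) 1%R).
    { replace 1%R with (Cmod (convpow c 0 0) * r ^ 0)%R by (simpl; rewrite Cmod_1; ring).
      apply (is_series_single (fun k => (Cmod (convpow c 0 k) * r ^ k)%R)).
      intros k. simpl. rewrite Cmod_0. ring. }
    split; [split; [apply H|]; split|].
    + eexists; exact E.
    + intros d Hd. simpl.
      pose proof (Cseries_single (fun k => convpow c 0 k * d ^ k)) as S0.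
      simpl in S0. replace (1 * 1) with (RtoC 1) in S0 by ring. apply S0.
      intros [|k] Hk; [lia|]. ring.
    + unfold wnorm. rewrite (is_series_unique _ _ E). simpl. lra.
  - destruct IHn as [I1 I2]. split.
    + apply (expands_ext (fun u => f u * f u ^ n)); [reflexivity|]. now apply expands_mult.
    + simpl. eapply Rle_trans; [apply wnorm_conv; [apply H|apply H|apply I1]|].
      apply Rmult_le_compat_l; [|exact I2].
      destruct H as [H0 [H1 _]]. apply wnorm_ge_0; [lra|exact H1].
Qed.

Definition psum (g : nat -> C) (v : C) : C := CSum (fun n => g n * v ^ n).

Lemma psum_correct g v rho : (Cmod v <= rho)%R -> ex_series (fun n => Cmod (g n) * rho ^ n)%R ->
  Cseries (fun n => g n * v ^ n) (psum g v).
Proof. intros H1 H2. apply CSum_abs. eapply ex_weight; eauto. Qed.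

Lemma sum_n_weight_le (c : nat -> C) r d K : (Cmod d <= r)%R ->
  ex_series (fun k => Cmod (c k) * r ^ k)%R ->
  (sum_n (fun k => Cmod (c k * d ^ k)) K <= wnorm c r)%R.
Proof.
  intros Hd Hc.
  assert (Hr : (0 <= r)%R) by (eapply Rle_trans; [apply Cmod_ge_0|exact Hd]).
  eapply Rle_trans; [|apply (sum_n_le_Series _ K); [|exact Hc]].
  - assert (T : forall k, (Cmod (c k * d ^ k) <= Cmod (c k) * r ^ k)%R).
    { intros k. rewrite Cmod_coef. apply Rmult_le_compat_l; [apply Cmod_ge_0|].
      apply pow_incr. split; [apply Cmod_ge_0|exact Hd]. }
    induction K; [rewrite !sum_O; apply T|]. rewrite !Rsum_S. specialize (T (S K)). lra.
  - intros k. apply Rmult_le_pos; [apply Cmod_ge_0|now apply pow_le].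
Qed.

Lemma wsum_le (c : nat -> C) (d l : C) r : (Cmod d <= r)%R ->
  ex_series (fun k => Cmod (c k) * r ^ k)%R ->
  Cseries (fun k => c k * d ^ k) l -> (Cmod l <= wnorm c r)%R.
Proof.
  intros Hd Hc Hl.
  replace l with (l - 0) by ring.
  apply (Cmod_lim_le eventually (Csum_n (fun k => c k * d ^ k))); [exact Hl|].
  exists 0%nat. intros n _.
  replace (Csum_n (fun k => c k * d ^ k) n - 0) with (Csum_n (fun k => c k * d ^ k) n) by ring.
  eapply Rle_trans; [apply Csum_norm|]. now apply sum_n_weight_le.
Qed.

(** Expanding each power in the sum of the [g n * phi(w+d)^n] gives a double
    series; its [n]-th row has norm at most [|g n| rho^n] since the weighted norm is
    submultiplicative, and exchanging the sums yields the power series of the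
    composite. *)
Lemma comp_series (g : nat -> C) (phi : C -> C) w c r rho d :
  expands phi w c r -> (wnorm c r <= rho)%R -> ex_series (fun n => Cmod (g n) * rho ^ n)%R ->
  (Cmod d <= r)%R ->
  Cseries (fun k => CSum (fun n => g n * convpow c n k) * d ^ k) (psum g (phi (w + d))).
Proof.
  intros He Hw Hg Hd.
  pose proof He as [Hr [Hc Hs]].
  assert (Hphi : (Cmod (phi (w + d)%C) <= rho)%R).
  { eapply Rle_trans; [|exact Hw]. apply (wsum_le c d); [exact Hd|exact Hc|exact (Hs d Hd)]. }
  assert (Hrho : (0 <= rho)%R) by (eapply Rle_trans; [apply Cmod_ge_0|exact Hphi]).
  assert (B : forall n, (wnorm (convpow c n) r <= rho ^ n)%R).
  { intros n. eapply Rle_trans; [apply (expands_pow phi w c r n He)|].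
    apply pow_incr. split; [|exact Hw]. apply wnorm_ge_0; [lra|exact Hc]. }
  assert (B' : forall d' n K, (Cmod d' <= r)%R ->
    (sum_n (fun k => Cmod (g n * convpow c n k * d' ^ k)) K <= Cmod (g n) * rho ^ n)%R).
  { intros d' n K Hd'.
    eapply Rle_trans; [|apply Rmult_le_compat_l; [apply Cmod_ge_0|apply (B n)]].
    eapply Rle_trans; [|apply Rmult_le_compat_l; [apply Cmod_ge_0|
      apply (sum_n_weight_le (convpow c n) r d' K Hd'); apply (expands_pow phi w c r n He)]].
    right. clear. induction K; [rewrite !sum_O, <- Cmod_mult; f_equal; ring|].
    rewrite !Rsum_S, IHK, Rmult_plus_distr_l, <- Cmod_mult. do 2 f_equal. ring. }
  apply (fubini (fun n k => g n * convpow c n k * d ^ k) (fun n => g n * phi (w + d) ^ n)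
    _ _ (fun n => Cmod (g n) * rho ^ n)%R).
  - intros n K. now apply B'.
  - exact Hg.
  - intros n. apply (Cseries_ext (fun k => g n * (convpow c n k * d ^ k))); [intros; ring|].
    apply Cseries_scal. apply (expands_pow phi w c r n He); exact Hd.
  - eapply psum_correct; eauto.
  - intros k.
    apply (Cseries_ext (fun n => d ^ k * (g n * convpow c n k))); [intros; ring|].
    rewrite Cmult_comm. apply Cseries_scal.
    apply (CSum_dominated _ (fun n => Cmod (g n) * rho ^ n * / r ^ k)%R).
    + intros n.
      assert (Hr' : (Cmod (RtoC r) <= r)%R) by (rewrite Cmod_R, Rabs_pos_eq; lra).
      pose proof (B' (RtoC r) n k Hr') as Q.
      pose proof (sum_n_ge_term (fun k => Cmod (g n * convpow c n k * (RtoC r) ^ k)) k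
        ltac:(intros; apply Cmod_ge_0)) as Q2. simpl in Q2.
      rewrite Cmod_mult, Cmod_pow, Cmod_R, (Rabs_pos_eq r) in Q2 by lra.
      apply (Rmult_le_reg_r (r ^ k)); [apply pow_lt, Hr|].
      rewrite Rmult_assoc, Rinv_l, Rmult_1_r by (apply pow_nonzero; lra). lra.
    + exact (ex_series_scal_r (/ r ^ k) _ Hg).
Qed.

Definition analytic_at (f : C -> C) (w : C) : Prop := exists c r, expands f w c r.

Lemma analytic_at_on (U : C -> Prop) f : (forall w, U w -> analytic_at f w) -> analytic_on U f.
Proof.
  intros H w Hw. destruct (H w Hw) as [c [r [H1 [H2 H3]]]].
  exists c, r. split; [exact H1|]. intros u Hu. apply is_pseries_C.
  replace (f u) with (f (w + (u - w))) by (f_equal; ring). apply H3. lra.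
Qed.

Lemma analytic_on_at (U : C -> Prop) f w : analytic_on U f -> U w -> analytic_at f w.
Proof.
  intros H Hw. destruct (H w Hw) as [c [r [H1 H2]]]. exists c, (r / 2)%R.
  apply (expands_intro f w c r); [lra|]. intros d Hd.
  apply is_pseries_C. replace d with ((w + d) - w) at 1 by ring. apply H2.
  replace (w + d - w) with d by ring. exact Hd.
Qed.

Lemma analytic_at_mult f g w : analytic_at f w -> analytic_at g w -> analytic_at (fun u => f u * g u) w.
Proof.
  intros [a [r H]] [b [s G]].
  assert (0 < Rmin r s)%R by (apply Rmin_pos; [apply H|apply G]).
  exists (conv a b), (Rmin r s). apply expands_mult; eapply expands_le; eauto; split; auto.
  apply Rmin_l. apply Rmin_r.
Qed.

Lemma analytic_at_minus f g w : analytic_at f w -> analytic_at g w -> analytic_at (fun u => f u - g u) w.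
Proof.
  intros [a [r H]] [b [s G]].
  assert (0 < Rmin r s)%R by (apply Rmin_pos; [apply H|apply G]).
  exists (fun k => a k - b k), (Rmin r s). apply expands_minus; eapply expands_le; eauto; split; auto.
  apply Rmin_l. apply Rmin_r.
Qed.

Lemma expands_center f w c r : expands f w c r -> c 0%nat = f w.
Proof.
  intros [H1 [_ H3]]. specialize (H3 0 ltac:(rewrite Cmod_0; lra)).
  replace (w + 0) with w in H3 by ring.
  assert (Q : Cseries (fun k => c k * 0 ^ k) (c 0%nat * 0 ^ 0)).
  { apply (Cseries_single (fun k => c k * 0 ^ k)). intros [|n] Hn; [lia|]. rewrite Cpow_S. ring. }
  replace (c 0%nat * 0 ^ 0) with (c 0%nat) in Q by (simpl; ring).
  exact (Cseries_unique _ _ _ Q H3).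
Qed.

(** All terms but the constant one carry a factor of the radius, so the norm tends
    to the modulus of the constant term as the radius shrinks. *)
Lemma wnorm_small c r rho : (0 < r)%R -> ex_series (fun k => Cmod (c k) * r ^ k)%R ->
  (Cmod (c 0%nat) < rho)%R -> exists r', (0 < r' <= r)%R /\ (wnorm c r' <= rho)%R.
Proof.
  intros Hr Hc Hrho.
  set (W := wnorm c r).
  assert (HW : (0 <= W)%R).
  { apply wnorm_ge_0; [lra|exact Hc]. }
  set (t := Rmin 1 ((rho - Cmod (c 0%nat)) / (W + 1))).
  assert (Ht : (0 < t <= 1)%R).
  { split; [|apply Rmin_l]. apply Rmin_pos; [lra|]. apply Rdiv_lt_0_compat; lra. }
  assert (Ht2 : (t * W <= rho - Cmod (c 0%nat))%R).
  { eapply Rle_trans; [apply Rmult_le_compat_r; [exact HW|apply Rmin_r]|].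
    apply (Rmult_le_reg_r (W + 1)); [lra|].
    replace ((rho - Cmod (c 0%nat)) / (W + 1) * W * (W + 1))%R with ((rho - Cmod (c 0%nat)) * W)%R by (field; lra).
    apply Rmult_le_compat_l; lra. }
  exists (t * r)%R.
  assert (Htr : (0 < t * r <= r)%R).
  { split; [apply Rmult_lt_0_compat; lra|]. rewrite <- (Rmult_1_l r) at 2. apply Rmult_le_compat_r; lra. }
  split; [exact Htr|].
  pose proof (ex_wseries_le c r (t * r) ltac:(lra) Hc) as Hc'.
  unfold wnorm. rewrite Series_incr_1 by exact Hc'.
  assert (Q : (Series (fun k => Cmod (c (S k)) * (t * r) ^ S k) <=
     Series (fun k => t * (Cmod (c (S k)) * r ^ S k)))%R).
  { apply Series_le.
    - intros n. split; [apply Rmult_le_pos; [apply Cmod_ge_0|apply pow_le; lra]|].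
      rewrite Rpow_mult_distr.
      replace (t * (Cmod (c (S n)) * r ^ S n))%R with (Cmod (c (S n)) * (t * r ^ S n))%R by ring.
      apply Rmult_le_compat_l; [apply Cmod_ge_0|]. apply Rmult_le_compat_r; [apply pow_le; lra|].
      simpl. pose proof (pow_incr t 1 n ltac:(lra)) as T1. rewrite pow1 in T1.
      apply (Rmult_le_compat_l t) in T1; lra.
    - apply (ex_series_scal_l t (fun k => Cmod (c (S k)) * r ^ S k)%R).
      apply (ex_series_incr_1 (fun k => Cmod (c k) * r ^ k)%R). exact Hc. }
  rewrite Series_scal_l in Q.
  assert (Q2 : (W = Cmod (c 0%nat) * r ^ 0 + Series (fun k => Cmod (c (S k)) * r ^ S k))%R).
  { unfold W, wnorm. now rewrite Series_incr_1 by exact Hc. }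
  simpl pow at 1. simpl (r ^ 0)%R in Q2.
  pose proof (Cmod_ge_0 (c 0%nat)).
  assert (t * Series (fun k => Cmod (c (S k)) * r ^ S k) <= t * W)%R.
  { apply Rmult_le_compat_l; [lra|]. rewrite Q2. lra. }
  lra.
Qed.

(** Shrink the radius until the weighted norm of [phi] is below [R0]. *)
Lemma analytic_at_comp (g : nat -> C) (phi : C -> C) w R0 :
  (forall rho, (0 <= rho < R0)%R -> ex_series (fun n => Cmod (g n) * rho ^ n)%R) ->
  (Cmod (phi w) < R0)%R -> analytic_at phi w -> analytic_at (fun u => psum g (phi u)) w.
Proof.
  intros Hg Hw [c [r He]].
  pose proof (expands_center _ _ _ _ He) as E. rewrite <- E in Hw.
  pose proof (Cmod_ge_0 (c 0%nat)).
  destruct (wnorm_small c r ((Cmod (c 0%nat) + R0) / 2)) as [r' [Hr' Hn]];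
    [apply He|apply He|lra|].
  pose proof (expands_le _ _ _ _ _ Hr' He) as He'.
  exists (fun k => CSum (fun n => g n * convpow c n k)), (r' / 2)%R.
  apply (expands_intro _ _ _ r'); [lra|]. intros d Hd.
  eapply comp_series; [exact He'|exact Hn| |lra]. apply Hg. lra.
Qed.

Lemma Cgeom v : (Cmod v < 1)%R -> Cseries (fun n => v ^ n) (/ (1 - v)).
Proof.
  intros H.
  assert (N1 : 1 - v <> 0).
  { intros E. assert (v = 1) by (replace v with (1 - (1 - v)) by ring; rewrite E; ring).
    subst v. rewrite Cmod_1 in H. lra. }
  assert (S1 : Cseries (fun n => v ^ n) (CSum (fun n => v ^ n))).
  { apply CSum_abs. eapply ex_series_ext; [intros n; symmetry; apply Cmod_pow|].
    apply ex_series_geom. rewrite Rabs_pos_eq; [exact H|apply Cmod_ge_0]. }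
  set (s := CSum (fun n => v ^ n)) in *.
  assert (S2 : Cseries (fun n => v ^ n) (1 + v * s)).
  { apply Cseries_cons. simpl. replace (1 + v * s - 1) with (v * s) by ring.
    now apply Cseries_scal. }
  pose proof (Cseries_unique _ _ _ S1 S2) as E.
  replace (/ (1 - v)) with s; [exact S1|].
  assert (E2 : s * (1 - v) = 1) by (replace (s * (1 - v)) with (s - v * s) by ring; rewrite E at 1; ring).
  transitivity (s * (1 - v) * / (1 - v)); [field; exact N1|rewrite E2; ring].
Qed.

Lemma analytic_at_id w : analytic_at (fun u => u) w.
Proof.
  exists (fun k => match k with O => w | S O => 1 | _ => 0 end), 1%R.
  apply (expands_intro _ _ _ 2); [lra|]. intros d _.
  pose proof (Cseries_finite (fun k => (match k with O => w | S O => 1 | _ => 0 end) * d ^ k) 1) as Q.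
  rewrite Csum_S, Csum_0 in Q. cbv beta iota in Q.
  replace (w * d ^ 0 + 1 * d ^ 1) with (w + d) in Q by (simpl; ring). apply Q.
  intros [|[|n]] Hn; try lia. apply Cmult_0_l.
Qed.

(** [u/(u-1) = 1 - 1/(1-u)], and the last term is a geometric series around any
    centre. *)
Lemma analytic_at_pfaff (w : C) : w <> 1 -> analytic_at (fun u => u / (u - 1)) w.
Proof.
  intros Hw.
  assert (N1 : 1 - w <> 0) by (intros E; apply Hw; symmetry; now apply Ceq_minus).
  exists (fun k => (match k with O => 1 | _ => 0 end) - (/ (1 - w)) ^ S k), (Cmod (1 - w) / 2)%R.
  assert (P : (0 < Cmod (1 - w))%R) by now apply Cmod_gt_0.
  apply (expands_intro _ _ _ (Cmod (1 - w))); [lra|]. intros d Hd.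
  assert (N2 : 1 - (w + d) <> 0).
  { intros E. assert (d = 1 - w) by (replace (1 - w) with (1 - (w + d) + d) by ring; rewrite E; ring).
    subst d. lra. }
  assert (Hq : (Cmod (d / (1 - w)) < 1)%R).
  { rewrite Cmod_div by exact N1. apply Rlt_div_l; lra. }
  assert (G := Cseries_scal (/ (1 - w)) _ _ (Cgeom _ Hq)).
  assert (G2 := Cseries_single (fun k => (match k with O => 1 | _ => 0 end) * d ^ k)).
  specialize (G2 ltac:(intros [|n] Hn; [lia|apply Cmult_0_l])).
  eapply Cseries_ext; [|replace ((w + d) / (w + d - 1)) with
     (1 * d ^ 0 - / (1 - w) * / (1 - d / (1 - w)))].
  2: apply (Cseries_minus _ _ _ _ G2 G).
  - intros n. simpl. unfold Cdiv. rewrite Cpow_mult_l. ring.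
  - simpl. field.
    assert (X : 1 - w - d <> 0) by (intros E; apply N2; rewrite <- E; ring).
    repeat split; auto; intros E; apply N2.
    + replace (1 - (w + d)) with (- (w + d - 1)) by ring. rewrite E; ring.
Qed.

(** * The identity theorem and uniqueness of the continuation *)

(** Close to the centre the constant term dominates the sum of all others. *)
Lemma ray_zero_head (c : nat -> C) (r : R) (e : C) (s0 : R) : (0 < r)%R -> (0 < s0)%R ->
  ex_series (fun k => Cmod (c k) * r ^ k)%R ->
  (forall s : R, (0 < s < s0)%R -> Cseries (fun k => c k * (s * e) ^ k) (RtoC 0)) ->
  c 0%nat = 0.
Proof.
  intros Hr Hs0 Hc H.
  destruct (Ceq_dec (c 0%nat) 0) as [E|E]; [exact E|exfalso].
  assert (P : (0 < Cmod (c 0%nat))%R) by now apply Cmod_gt_0.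
  (* The series without its constant term sums to [- c 0] on the ray. *)
  set (c' := fun k => match k with O => RtoC 0 | S _ => c k end).
  assert (Hc' : ex_series (fun k => Cmod (c' k) * r ^ k)%R).
  { apply (ex_series_Rle _ (fun k => Cmod (c k) * r ^ k)%R); [|exact Hc].
    intros [|n]; simpl; split.
    - rewrite Cmod_0; lra.
    - rewrite Cmod_0. lra.
    - apply Rmult_le_pos; [apply Cmod_ge_0|]. change (0 <= r ^ S n)%R. apply pow_le; lra.
    - lra. }
  destruct (wnorm_small c' r (Cmod (c 0%nat) / 2) Hr Hc') as [r' [Hr' Hw]].
  { simpl. rewrite Cmod_0. lra. }
  pose proof (Cmod_ge_0 e) as He.
  set (s := Rmin (s0 / 2) (r' / (Cmod e + 1))).
  assert (Hs : (0 < s < s0)%R).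
  { split; [apply Rmin_pos; [lra|apply Rdiv_lt_0_compat; lra]|].
    eapply Rle_lt_trans; [apply Rmin_l|lra]. }
  assert (Hd : (Cmod (s * e) <= r')%R).
  { rewrite Cmod_mult, Cmod_R, Rabs_pos_eq by lra.
    eapply Rle_trans; [apply Rmult_le_compat_r; [lra|apply Rmin_r]|].
    unfold Rdiv. rewrite Rmult_assoc. rewrite <- (Rmult_1_r r') at 2.
    apply Rmult_le_compat_l; [lra|]. apply (Rmult_le_reg_l (Cmod e + 1)); [lra|].
    rewrite <- Rmult_assoc, Rinv_r by lra. lra. }
  assert (Q : Cseries (fun k => c' k * (s * e) ^ k) (0 - c 0%nat * (s * e) ^ 0)).
  { apply (Cseries_ext (fun k => c k * (s * e) ^ k - match k with O => c 0%nat * (s * e) ^ 0 | _ => 0 end)).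
    - intros [|n]; cbv beta iota delta [c']; ring.
    - apply Cseries_minus; [now apply H|].
      apply (Cseries_single (fun k => match k with O => c 0%nat * (s * e) ^ 0 | _ => 0 end)).
      intros [|n] Hn; [lia|reflexivity]. }
  pose proof (wsum_le c' _ _ r' Hd (ex_wseries_le c' r r' ltac:(lra) Hc') Q) as B.
  replace (0 - c 0%nat * (s * e) ^ 0) with (- c 0%nat) in B by (simpl; ring).
  rewrite Cmod_opp in B. lra.
Qed.

(** After the constant term is known to vanish, division by the variable leaves a
    series that vanishes on the same ray. *)
Lemma ray_zero k : forall (c : nat -> C) (r : R) (e : C) (s0 : R), (0 < r)%R -> (0 < s0)%R -> e <> 0 ->
  ex_series (fun k => Cmod (c k) * r ^ k)%R ->
  (forall s : R, (0 < s < s0)%R -> Cseries (fun k => c k * (s * e) ^ k) (RtoC 0)) ->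
  c k = 0.
Proof.
  induction k; intros c r e s0 Hr Hs0 He Hc H.
  - exact (ray_zero_head c r e s0 Hr Hs0 Hc H).
  - pose proof (ray_zero_head c r e s0 Hr Hs0 Hc H) as Z.
    apply (IHk (fun k => c (S k)) r e s0 Hr Hs0 He).
    + apply (ex_series_ext (fun k => / r * (Cmod (c (S k)) * r ^ S k))%R).
      * intros n. simpl. field. lra.
      * apply (ex_series_scal_l (/ r)%R (fun k => Cmod (c (S k)) * r ^ S k)%R).
        apply (ex_series_incr_1 (fun k => Cmod (c k) * r ^ k)%R). exact Hc.
    + intros s Hs. specialize (H s Hs).
      assert (Hse : s * e <> 0).
      { apply Cmult_neq_0; [|exact He]. intros E. apply RtoC_inj in E. lra. }
      assert (Q : Cseries (fun k => c (S k) * (s * e) ^ S k) (RtoC 0)).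
      { apply (is_series_incr_1 (V := C_NormedModule) (fun k => c k * (s * e) ^ k)).
        change (Cseries (fun k => c k * (s * e) ^ k) (0 + c 0%nat * (s * e) ^ 0)).
        rewrite Z. replace (0 + 0 * (s * e) ^ 0) with (RtoC 0) by ring. exact H. }
      apply (Cseries_scal (/ (s * e))) in Q.
      replace (/ (s * e) * 0) with (RtoC 0) in Q by ring.
      apply (Cseries_ext (fun k => / (s * e) * (c (S k) * (s * e) ^ S k))); [|exact Q]. intros n. rewrite Cpow_S.
      transitivity (/ (s * e) * (s * e) * (c (S n) * (s * e) ^ n)); [ring|].
      rewrite Cinv_l by exact Hse. ring.
Qed.

(** Fix [u] and let [m] be the supremum of the [s] such that [h] vanishes on the
    segment from 0 to [s u], a segment that lies in [U] because [U] is star-shaped.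
    The expansion of [h] at [m u] vanishes along the ray towards 0, hence is zero, so
    [h] vanishes past [m u]; thus [m] is 1. *)
Lemma identity_theorem (U : C -> Prop) (h : C -> C) r : star_shaped U ->
  (forall w, U w -> analytic_at h w) -> (0 < r)%R ->
  (forall u, U u -> (Cmod u < r)%R -> h u = 0) -> forall u, U u -> h u = 0.
Proof.
  intros HU Hh Hr Hz u Hu.
  destruct (Ceq_dec u 0) as [->|Nu]; [apply Hz; [exact Hu|rewrite Cmod_0; exact Hr]|].
  assert (Pu : (0 < Cmod u)%R) by now apply Cmod_gt_0.
  set (E := fun s => (0 <= s <= 1)%R /\ forall s', (0 <= s' <= s)%R -> h (RtoC s' * u) = 0).
  assert (E0 : E 0%R).
  { split; [lra|]. intros s' Hs'. replace s' with 0%R by lra.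
    apply Hz; [apply HU; [exact Hu|lra]|]. rewrite Cmult_0_l, Cmod_0. exact Hr. }
  destruct (completeness E) as [m [Hm1 Hm2]].
  { exists 1%R. intros s [Hs _]. lra. }
  { exists 0%R. exact E0. }
  assert (Hm : (0 <= m <= 1)%R).
  { split; [now apply Hm1|]. apply Hm2. intros s [Hs _]; lra. }
  assert (Hlt : forall s, (0 <= s < m)%R -> h (RtoC s * u) = 0).
  { intros s Hs.
    destruct (Classical_Prop.classic (h (RtoC s * u) = 0)) as [Y|Y]; [exact Y|exfalso].
    assert (m <= s)%R; [|lra]. apply Hm2. intros t [Ht1 Ht2].
    apply Rnot_lt_le. intros Hts. apply Y, Ht2. lra. }
  assert (Hnear : exists eps, (0 < eps)%R /\ forall s, (0 <= s <= 1)%R -> (Rabs (s - m) < eps)%R ->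
     h (RtoC s * u) = 0).
  { destruct (Req_dec m 0) as [Z|Z].
    - exists (r / Cmod u)%R. split; [now apply Rdiv_lt_0_compat|].
      intros s Hs Hs2. apply Hz; [now apply HU|].
      rewrite Cmod_mult, Cmod_R. subst m. rewrite Rminus_0_r in Hs2.
      apply Rlt_div_r in Hs2; lra.
    - destruct (Hh _ (HU u m Hu Hm)) as [c [rho [H1 [H2 H3]]]].
      assert (Hc : forall k, c k = 0).
      { intros k. apply (ray_zero k c rho (- u) (Rmin m (rho / Cmod u))); auto.
        - apply Rmin_pos; [lra|now apply Rdiv_lt_0_compat].
        - intros A. apply Nu. replace u with (- - u) by ring. rewrite A. ring.
        - intros s Hs.
          pose proof (Rmin_l m (rho / Cmod u)). pose proof (Rmin_r m (rho / Cmod u)).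
          rewrite <- (Hlt (m - s)%R) by lra.
          replace (RtoC (m - s) * u) with (m * u + s * - u) by (rewrite RtoC_minus; ring).
          apply H3. rewrite Cmod_mult, Cmod_opp, Cmod_R, Rabs_pos_eq by lra.
          assert (s < rho / Cmod u)%R as Q by lra. apply Rlt_div_r in Q; lra. }
      exists (rho / Cmod u)%R. split; [now apply Rdiv_lt_0_compat|].
      intros s Hs Hs2.
      replace (RtoC s * u) with (m * u + (s - m)%R * u) by (rewrite RtoC_minus; ring).
      assert (Hd : (Cmod ((s - m)%R * u) <= rho)%R).
      { rewrite Cmod_mult, Cmod_R. apply Rlt_div_r in Hs2; lra. }
      apply (Cseries_unique _ _ _ (H3 _ Hd)).
      apply (Cseries_ext (fun _ => RtoC 0)); [intros n; rewrite Hc; ring|].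
      apply (Cseries_single (fun _ => RtoC 0)). reflexivity. }
  destruct Hnear as [eps [He Hn]].
  assert (HE : E (Rmin 1 (m + eps / 2))).
  { split.
    - split; [apply Rmin_glb; lra|apply Rmin_l].
    - intros s' Hs'. pose proof (Rmin_l 1 (m + eps / 2)). pose proof (Rmin_r 1 (m + eps / 2)).
      destruct (Rlt_le_dec s' m); [apply Hlt; lra|]. apply Hn; [lra|].
      rewrite Rabs_pos_eq; lra. }
  assert (Q : (1 <= m + eps / 2)%R).
  { apply Rnot_lt_le. intros L. pose proof (Hm1 _ HE) as K. rewrite Rmin_right in K; lra. }
  rewrite Rmin_left in HE by exact Q.
  replace u with (RtoC 1 * u) by ring. apply HE. lra.
Qed.

Lemma is_hyp2F1_unique A B c w v v' : is_hyp2F1 A B c w v -> is_hyp2F1 A B c w v' -> v = v'.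
Proof.
  intros [U [f [U1 [U2 [U3 [U4 [U5 [U6 U7]]]]]]]] [U' [f' [U1' [U2' [U3' [U4' [U5' [U6' U7']]]]]]]].
  subst v v'.
  apply Ceq_minus.
  apply (identity_theorem (fun u => U u /\ U' u) (fun u => f u - f' u) 1).
  - intros u t [H H'] Ht. split; [now apply U2|now apply U2'].
  - intros u [H H']. apply analytic_at_minus; eapply analytic_on_at; eauto.
  - lra.
  - intros u [H H'] Hm.
    pose proof (proj1 (is_pseries_C _ _ _) (U6 u H Hm)) as P1.
    pose proof (proj1 (is_pseries_C _ _ _) (U6' u H' Hm)) as P2.
    rewrite (Cseries_unique _ _ _ P1 P2). ring.
  - split; assumption.
Qed.

(** * Pochhammer symbols and convolution sums *)

Definition ifact (n : nat) : C := / RtoC (INR (fact n)).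

Lemma fact_C_neq_0 n : RtoC (INR (fact n)) <> 0.
Proof. intros E. apply RtoC_inj in E. exact (INR_fact_neq_0 n E). Qed.

Lemma INR_S_C n : RtoC (INR (S n)) = INR n + 1.
Proof. now rewrite S_INR, RtoC_plus. Qed.

Lemma INR_S_neq_0 n : RtoC (INR n) + 1 <> 0.
Proof. rewrite <- INR_S_C. intros E. apply RtoC_inj in E. revert E. apply not_0_INR. lia. Qed.

Lemma fact_S_C n : RtoC (INR (fact (S n))) = (INR n + 1) * INR (fact n).
Proof. now rewrite fact_simpl, mult_INR, RtoC_mult, INR_S_C. Qed.

Lemma ifact_S n : INR (S n) * ifact (S n) = ifact n.
Proof.
  unfold ifact. rewrite fact_S_C, INR_S_C. field. split; [apply fact_C_neq_0|apply INR_S_neq_0].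
Qed.

(** Binomial sums, divided by [k!]: the weights are products of inverse
    factorials. *)
Definition binsum (F : nat -> nat -> C) (k : nat) : C :=
  Csum_n (fun n => F n (k - n)%nat * (ifact n * ifact (k - n))) k.

(** Pascal's rule: split [k+1 = n + (k+1-n)] and cancel each part against one of
    the two factorials.  Both convolution identities below follow by induction. *)
Lemma binsum_S F k :
  INR (S k) * binsum F (S k) =
  binsum (fun n m => F (S n) m) k + binsum (fun n m => F n (S m)) k.
Proof.
  unfold binsum. rewrite <- Csum_scal.
  rewrite (Csum_ext _ (fun n => F n (S k - n)%nat * (INR n * ifact n * ifact (S k - n)) +
     F n (S k - n)%nat * (ifact n * (INR (S k - n) * ifact (S k - n))))).
  - rewrite Csum_plus. f_equal.
    + rewrite Csum_first. simpl (INR 0).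
      replace (F 0%nat (S k - 0)%nat * (0 * ifact 0 * ifact (S k - 0))) with (RtoC 0) by ring.
      rewrite Cplus_0_l. apply Csum_ext. intros n Hn.
      rewrite ifact_S. reflexivity.
    + rewrite Csum_S. rewrite Nat.sub_diag. simpl (INR 0).
      rewrite Cmult_0_l, Cmult_0_r, Cmult_0_r, Cplus_0_r.
      apply Csum_ext. intros n Hn. replace (S k - n)%nat with (S (k - n)) by lia.
      now rewrite ifact_S.
  - intros n Hn.
    replace (RtoC (INR (S k))) with (INR n + INR (S k - n)).
    + ring.
    + rewrite <- RtoC_plus, <- plus_INR. do 2 f_equal. lia.
Qed.

Lemma binsum_ext F G k : (forall n m, F n m = G n m) -> binsum F k = binsum G k.
Proof. intros H. apply Csum_ext. intros. now rewrite H. Qed.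

Lemma binsum_scal x F k : binsum (fun n m => x * F n m) k = x * binsum F k.
Proof. unfold binsum. rewrite <- Csum_scal. apply Csum_ext. intros; ring. Qed.

Lemma pochhammer_S s n : pochhammer s (S n) = pochhammer s n * (s + INR n).
Proof. reflexivity. Qed.

Lemma pochhammer_first s n : pochhammer s (S n) = s * pochhammer (s + 1) n.
Proof.
  induction n.
  - simpl. ring.
  - rewrite pochhammer_S, IHn, pochhammer_S, INR_S_C. ring.
Qed.

Lemma pochhammer_add s n m : pochhammer s (n + m) = pochhammer s n * pochhammer (s + INR n) m.
Proof.
  induction m.
  - rewrite Nat.add_0_r. simpl. ring.
  - rewrite Nat.add_succ_r, !pochhammer_S, IHm, plus_INR, RtoC_plus. ring.
Qed.

Lemma pochhammer_one n : pochhammer 1 n = INR (fact n).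
Proof.
  induction n; [reflexivity|].
  rewrite pochhammer_S, IHn, fact_S_C. ring.
Qed.

Lemma nonpos_int_add_neq_0 c n : ~ nonpos_int c -> c + INR n <> 0.
Proof.
  intros H E. apply H. exists n. replace c with ((c + INR n) - INR n) by ring. rewrite E. ring.
Qed.

Lemma pochhammer_neq_0 c n : ~ nonpos_int c -> pochhammer c n <> 0.
Proof.
  intros H. induction n; [apply C1_nz|].
  rewrite pochhammer_S. apply Cmult_neq_0; [exact IHn|]. now apply nonpos_int_add_neq_0.
Qed.

Lemma nonpos_int_add c n : ~ nonpos_int c -> ~ nonpos_int (c + INR n).
Proof.
  intros H [m E]. apply H. exists (m + n)%nat. rewrite plus_INR, RtoC_plus.
  replace c with ((c + INR n) - INR n) by ring. rewrite E. ring.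
Qed.

(** Vandermonde's convolution, the product rule of binomial series. *)
Lemma binsum_pochhammer A B k :
  binsum (fun n m => pochhammer A n * pochhammer B m) k = pochhammer (A + B) k * ifact k.
Proof.
  revert A B. induction k; intros A B.
  - unfold binsum. rewrite Csum_0. unfold ifact. simpl. field.
  - assert (N : RtoC (INR (S k)) <> 0) by (rewrite INR_S_C; apply INR_S_neq_0).
    assert (E : INR (S k) * binsum (fun n m => pochhammer A n * pochhammer B m) (S k) =
            INR (S k) * (pochhammer (A + B) (S k) * ifact (S k))).
    { rewrite binsum_S.
      rewrite (binsum_ext _ (fun n m => A * (pochhammer (A + 1) n * pochhammer B m)))
        by (intros; rewrite pochhammer_first; ring).
      rewrite (binsum_ext (fun n m => _ * pochhammer B (S m)) (fun n m => B * (pochhammer A n * pochhammer (B + 1) m)))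
        by (intros; rewrite pochhammer_first; ring).
      rewrite !binsum_scal, !IHk.
      replace (INR (S k) * (pochhammer (A + B) (S k) * ifact (S k))) with
        (pochhammer (A + B) (S k) * (INR (S k) * ifact (S k))) by ring.
      rewrite ifact_S, pochhammer_first.
      replace (A + 1 + B) with (A + B + 1) by ring.
      replace (A + (B + 1)) with (A + B + 1) by ring. ring. }
    apply (f_equal (Cmult (/ INR (S k)))) in E.
    rewrite !Cmult_assoc, !Cinv_l, !Cmult_1_l in E by exact N. exact E.
Qed.

(** The sum of the terminating Gauss series at 1, divided by [k!]. *)
Lemma chu_vandermonde b c k : ~ nonpos_int c ->
  binsum (fun n m => (- (1)) ^ n * (pochhammer b n / pochhammer c n)) k =
  pochhammer (c - b) k / pochhammer c k * ifact k.
Proof.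
  revert b c. induction k; intros b c Hc.
  - unfold binsum. rewrite Csum_0. unfold ifact. simpl. field.
  - assert (N : RtoC (INR (S k)) <> 0) by (rewrite INR_S_C; apply INR_S_neq_0).
    assert (Nc : c <> 0). { intros E. apply Hc. exists 0%nat. simpl. rewrite E. ring. }
    assert (Hc1 : ~ nonpos_int (c + 1)) by exact (nonpos_int_add c 1 Hc).
    assert (E : INR (S k) * binsum (fun n m => (- (1)) ^ n * (pochhammer b n / pochhammer c n)) (S k) =
            INR (S k) * (pochhammer (c - b) (S k) / pochhammer c (S k) * ifact (S k))).
    { rewrite binsum_S.
      rewrite (binsum_ext _ (fun n m => (- (b / c)) * ((- (1)) ^ n * (pochhammer (b + 1) n / pochhammer (c + 1) n)))).
      2:{ intros n _. rewrite !pochhammer_first, Cpow_S. field.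
          split; [apply pochhammer_neq_0; exact Hc1|exact Nc]. }
      rewrite binsum_scal, IHk by exact Hc1. rewrite IHk by exact Hc.
      replace (INR (S k) * (pochhammer (c - b) (S k) / pochhammer c (S k) * ifact (S k))) with
        (pochhammer (c - b) (S k) / pochhammer c (S k) * (INR (S k) * ifact (S k))) by ring.
      rewrite ifact_S.
      replace (c + 1 - (b + 1)) with (c - b) by ring.
      assert (P1 : pochhammer c k <> 0) by now apply pochhammer_neq_0.
      assert (P2 : c + INR k <> 0) by now apply nonpos_int_add_neq_0.
      assert (P3 : c * pochhammer (c + 1) k = pochhammer c k * (c + INR k)).
      { rewrite <- pochhammer_first. reflexivity. }
      assert (P4 : pochhammer (c + 1) k = pochhammer c k * (c + INR k) / c).
      { rewrite <- P3. field. exact Nc. }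
      rewrite P4, !pochhammer_S. field. auto. }
    apply (f_equal (Cmult (/ INR (S k)))) in E.
    rewrite !Cmult_assoc, !Cinv_l, !Cmult_1_l in E by exact N. exact E.
Qed.

(** * The binomial series *)

(** Growth slower than every exponential.  The coefficients of all the series below
    have it, it is stable under products, and it implies convergence in the unit
    disc. *)
Definition subexp (g : nat -> R) : Prop :=
  forall q, (1 < q)%R -> exists K, (0 <= K)%R /\ forall n, (g n <= K * q ^ n)%R.

Lemma subexp_mult f g : (forall n, 0 <= f n)%R -> (forall n, 0 <= g n)%R ->
  subexp f -> subexp g -> subexp (fun n => f n * g n)%R.
Proof.
  intros Pf Pg Hf Hg q Hq.
  assert (H1 : (1 < sqrt q)%R) by (rewrite <- sqrt_1; apply sqrt_lt_1; lra).
  destruct (Hf _ H1) as [K [HK H]]. destruct (Hg _ H1) as [L [HL G]].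
  exists (K * L)%R. split; [now apply Rmult_le_pos|]. intros n.
  eapply Rle_trans; [apply Rmult_le_compat; [apply Pf|apply Pg|apply H|apply G]|].
  right. rewrite <- (sqrt_sqrt q) at 3 by lra. rewrite Rpow_mult_distr. ring.
Qed.

Lemma subexp_le f g : (forall n, f n <= g n)%R -> subexp g -> subexp f.
Proof.
  intros H Hg q Hq. destruct (Hg q Hq) as [K [HK G]]. exists K. split; [exact HK|].
  intros n. eapply Rle_trans; [apply H|apply G].
Qed.

Lemma subexp_series g rho : (0 <= rho < 1)%R -> (forall n, 0 <= g n)%R -> subexp g ->
  ex_series (fun n => g n * rho ^ n)%R.
Proof.
  intros Hr Pg Hg.
  assert (Hq : (1 < 2 / (1 + rho))%R) by (apply Rlt_div_r; lra).
  destruct (Hg _ Hq) as [K [HK G]].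
  apply (ex_series_Rle _ (fun n => K * (2 / (1 + rho) * rho) ^ n)%R).
  - intros n. split; [apply Rmult_le_pos; [apply Pg|apply pow_le; lra]|].
    rewrite Rpow_mult_distr, <- Rmult_assoc. apply Rmult_le_compat_r; [apply pow_le; lra|apply G].
  - apply ex_series_geom_scal. split.
    + apply Rmult_le_pos; lra.
    + replace (2 / (1 + rho) * rho)%R with (2 * rho / (1 + rho))%R by (field; lra).
      apply Rlt_div_l; lra.
Qed.

(** The ratio of consecutive terms is [(a+n)/(c+n)], which tends to 1. *)
Lemma subexp_pochhammer_ratio a c : ~ nonpos_int c ->
  subexp (fun n => Cmod (pochhammer a n / pochhammer c n)).
Proof.
  intros Hc q Hq.
  destruct (INR_unbounded (Cmod c + Cmod (a - c) / (q - 1))) as [N HN].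
  apply (geom_bound _ q N); [lra|intros; apply Cmod_ge_0|].
  intros n Hn. rewrite !pochhammer_S.
  assert (P : c + INR n <> 0) by now apply nonpos_int_add_neq_0.
  replace (pochhammer a n * (a + INR n) / (pochhammer c n * (c + INR n))) with
    ((a + INR n) / (c + INR n) * (pochhammer a n / pochhammer c n)).
  2:{ field. split; [exact P|now apply pochhammer_neq_0]. }
  rewrite Cmod_mult. apply Rmult_le_compat_r; [apply Cmod_ge_0|].
  rewrite Cmod_div by exact P.
  assert (P' : (0 < Cmod (c + INR n))%R) by now apply Cmod_gt_0.
  apply Rle_div_l; [exact P'|].
  assert (T1 : (Cmod (a + INR n) <= Cmod (a - c) + Cmod (c + INR n))%R).
  { replace (a + INR n) with ((a - c) + (c + INR n)) by ring. apply Cmod_triangle. }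
  assert (T2 : (INR n <= Cmod (c + INR n) + Cmod c)%R).
  { rewrite <- (Cmod_opp c). rewrite <- (Rabs_pos_eq (INR n)) at 1 by apply pos_INR.
    rewrite <- Cmod_R. replace (RtoC (INR n)) with ((c + INR n) + - c) at 1 by ring. apply Cmod_triangle. }
  assert (T3 : (INR N <= INR n)%R) by now apply le_INR.
  assert (T4 : (Cmod (a - c) / (q - 1) <= Cmod (c + INR n))%R) by lra.
  apply Rle_div_l in T4; [|lra]. lra.
Qed.

Lemma one_not_nonpos : ~ nonpos_int 1.
Proof.
  intros [n E]. rewrite <- RtoC_opp in E. apply RtoC_inj in E. pose proof (pos_INR n). lra.
Qed.

Definition bcoef (a : C) (n : nat) : C := pochhammer a n * ifact n.

Lemma subexp_bcoef a : subexp (fun n => Cmod (bcoef a n)).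
Proof.
  apply (subexp_le _ (fun n => Cmod (pochhammer a n / pochhammer 1 n))).
  - intros n. right. now rewrite pochhammer_one.
  - apply subexp_pochhammer_ratio, one_not_nonpos.
Qed.

Lemma hyp2F1_coef_bcoef a b c n :  ~ nonpos_int c ->
  hyp2F1_coef a b c n = bcoef a n * (pochhammer b n / pochhammer c n).
Proof.
  intros Hc. unfold hyp2F1_coef, bcoef, ifact. field.
  split; [now apply pochhammer_neq_0|apply fact_C_neq_0].
Qed.

Lemma subexp_hyp a b c : ~ nonpos_int c -> subexp (fun n => Cmod (hyp2F1_coef a b c n)).
Proof.
  intros Hc.
  apply (subexp_le _ (fun n => Cmod (bcoef a n) * Cmod (pochhammer b n / pochhammer c n))%R).
  - intros n. rewrite hyp2F1_coef_bcoef, Cmod_mult by exact Hc. lra.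
  - apply subexp_mult; try (intros; apply Cmod_ge_0).
    + apply subexp_bcoef.
    + now apply subexp_pochhammer_ratio.
Qed.

Lemma subexp_psum (g : nat -> C) v : subexp (fun n => Cmod (g n)) -> (Cmod v < 1)%R ->
  Cseries (fun n => g n * v ^ n) (psum g v).
Proof.
  intros Hg Hv. apply (psum_correct g v (Cmod v)); [lra|].
  apply subexp_series; [split; [apply Cmod_ge_0|exact Hv]|intros; apply Cmod_ge_0|exact Hg].
Qed.

(** [(1-v)^(-a)] for [|v| < 1], without a choice of logarithm. *)
Definition binom (a v : C) : C := psum (bcoef a) v.

Lemma binom_correct a v : (Cmod v < 1)%R -> Cseries (fun n => bcoef a n * v ^ n) (binom a v).
Proof. apply subexp_psum, subexp_bcoef. Qed.

Lemma binom_mult a b v : (Cmod v < 1)%R -> binom a v * binom b v = binom (a + b) v.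
Proof.
  intros Hv.
  assert (S : forall a, ex_series (fun k => Cmod (bcoef a k * v ^ k))).
  { intros x. apply (ex_weight _ _ (Cmod v)); [lra|].
    apply (subexp_series (fun n => Cmod (bcoef x n))); [split; [apply Cmod_ge_0|exact Hv]|intros; apply Cmod_ge_0|apply subexp_bcoef]. }
  apply (Cseries_unique (fun n => bcoef (a + b) n * v ^ n)).
  - pose proof (cauchy_product _ _ _ _ (S a) (S b) (binom_correct a v Hv) (binom_correct b v Hv)) as P.
    eapply Cseries_ext; [|exact P]. intros k. rewrite conv_weight. f_equal.
    unfold bcoef at 3. rewrite <- binsum_pochhammer. apply Csum_ext. intros n Hn. unfold bcoef. ring.
  - now apply binom_correct.
Qed.

Lemma binom_0 v : (Cmod v < 1)%R -> binom 0 v = 1.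
Proof.
  intros Hv. apply (Cseries_unique _ _ _ (binom_correct 0 v Hv)).
  replace (RtoC 1) with (bcoef 0 0 * v ^ 0) by (unfold bcoef, ifact; simpl; field).
  apply (Cseries_single (fun n => bcoef 0 n * v ^ n)). intros [|n] Hn; [lia|].
  unfold bcoef. rewrite pochhammer_first. ring.
Qed.

Lemma binom_m1 v : (Cmod v < 1)%R -> binom (- (1)) v = 1 - v.
Proof.
  intros Hv. apply (Cseries_unique _ _ _ (binom_correct (- (1)) v Hv)).
  replace (1 - v) with (Csum_n (fun n => bcoef (- (1)) n * v ^ n) 1).
  2:{ rewrite Csum_S, Csum_0. unfold bcoef, ifact. simpl. field. }
  apply (Cseries_finite (fun n => bcoef (- (1)) n * v ^ n)). intros [|[|n]] Hn; try lia.
  unfold bcoef. rewrite !pochhammer_first.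
  replace (- (1) + 1) with (RtoC 0) by ring. ring.
Qed.

(** [binom (-a) v] is an inverse. *)
Lemma binom_neq_0 a v : (Cmod v < 1)%R -> binom a v <> 0.
Proof.
  intros Hv E. apply C1_nz. rewrite <- (binom_0 v Hv).
  replace (RtoC 0) with (a + - a) by ring. rewrite <- binom_mult, E by exact Hv. ring.
Qed.

Lemma binom_shift a v n : (Cmod v < 1)%R -> binom a v = (1 - v) ^ n * binom (a + INR n) v.
Proof.
  intros Hv. induction n.
  - simpl. replace (a + 0) with a by ring. ring.
  - rewrite IHn, Cpow_S. replace (a + INR n) with (- (1) + (a + INR (S n))) by (rewrite INR_S_C; ring).
    rewrite <- (binom_mult (- (1))), binom_m1 by exact Hv. ring.
Qed.

(** * Pfaff's transformation *)

(** Partial sums of the binomial series with the moduli of its terms.  For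
    [rho >= 0] the coefficients are nonnegative and the full sum is
    [(1-t)^(-rho)], which explains the factor [(1-t)^(-n)] gained when [rho] is
    shifted by [n]. *)
Definition bsum (rho t : R) (J : nat) : R :=
  sum_n (fun j => Cmod (bcoef rho j) * t ^ j)%R J.

Lemma bcoef_0 a : bcoef a 0 = 1.
Proof. unfold bcoef, ifact. simpl. field. Qed.

Lemma bcoef_S a j : bcoef a (S j) = (a + INR j) / INR (S j) * bcoef a j.
Proof.
  unfold bcoef. rewrite pochhammer_S, <- (ifact_S j), INR_S_C. field. apply INR_S_neq_0.
Qed.

Lemma bcoef_pascal a j : bcoef (a + 1) (S j) - bcoef (a + 1) j = bcoef a (S j).
Proof.
  unfold bcoef. rewrite (pochhammer_first a), pochhammer_S, <- (ifact_S j), INR_S_C. ring.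
Qed.

Lemma bcoef_real (rho : R) j : (0 <= rho)%R -> bcoef rho j = RtoC (Cmod (bcoef rho j)).
Proof.
  intros H. induction j.
  - now rewrite bcoef_0, Cmod_1.
  - rewrite bcoef_S, IHj, <- RtoC_plus, <- RtoC_div, <- RtoC_mult, Cmod_R, Rabs_pos_eq.
    + reflexivity.
    + apply Rmult_le_pos; [|apply Cmod_ge_0]. pose proof (pos_INR j).
      apply Rmult_le_pos; [lra|]. left. apply Rinv_0_lt_compat. rewrite S_INR. lra.
    + apply not_0_INR. lia.
Qed.

Lemma bcoef_le a (rho : R) j : (Cmod a <= rho)%R -> (Cmod (bcoef a j) <= Cmod (bcoef rho j))%R.
Proof.
  intros H. pose proof (Cmod_ge_0 a). induction j.
  - rewrite !bcoef_0. lra.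
  - rewrite !bcoef_S, !Cmod_mult.
    apply Rmult_le_compat; try apply Cmod_ge_0; [|exact IHj].
    assert (N : RtoC (INR (S j)) <> 0) by (rewrite INR_S_C; apply INR_S_neq_0).
    rewrite !Cmod_div by exact N. apply Rmult_le_compat_r.
    + left. apply Rinv_0_lt_compat. now apply Cmod_gt_0.
    + rewrite <- RtoC_plus. pose proof (pos_INR j). rewrite (Cmod_R (rho + INR j)), Rabs_pos_eq by lra.
      eapply Rle_trans; [apply Cmod_triangle|]. rewrite Cmod_R, Rabs_pos_eq; lra.
Qed.

(** Multiplication by [1-t] telescopes the sum for [rho+1] into the one for [rho],
    up to a last term of favourable sign. *)
Lemma bsum_step rho t J : (0 <= rho)%R -> (0 <= t < 1)%R ->
  (bsum (rho + 1) t J * (1 - t) <= bsum rho t J)%R.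
Proof.
  intros Hr Ht.
  assert (E : (bsum (rho + 1) t J * (1 - t) = bsum rho t J - Cmod (bcoef (rho + 1)%R J) * t ^ S J)%R).
  { unfold bsum. induction J.
    - rewrite !sum_O, !bcoef_0, !Cmod_1. simpl. ring.
    - rewrite !Rsum_S, Rmult_plus_distr_r, IHJ.
      assert (Q : (Cmod (bcoef rho (S J)) = Cmod (bcoef (rho + 1)%R (S J)) - Cmod (bcoef (rho + 1)%R J))%R).
      { apply RtoC_inj. rewrite RtoC_minus, <- !bcoef_real by lra. rewrite RtoC_plus.
        symmetry. apply bcoef_pascal. }
      rewrite Q. simpl. ring. }
  rewrite E. assert (0 <= Cmod (bcoef (rho + 1)%R J) * t ^ S J)%R; [|lra].
  apply Rmult_le_pos; [apply Cmod_ge_0|apply pow_le; lra].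
Qed.

Lemma bsum_bound rho t n J : (0 <= rho)%R -> (0 <= t < 1)%R ->
  (bsum (rho + INR n) t J <= bsum rho t J * (/ (1 - t)) ^ n)%R.
Proof.
  intros Hr Ht. induction n.
  - simpl. rewrite Rplus_0_r. lra.
  - rewrite S_INR, <- Rplus_assoc. pose proof (pos_INR n).
    pose proof (bsum_step (rho + INR n) t J ltac:(lra) Ht) as Q.
    apply Rle_div_r in Q; [|lra].
    eapply Rle_trans; [exact Q|]. unfold Rdiv. simpl.
    apply (Rmult_le_compat_r (/ (1 - t))) in IHn; [lra|]. left. apply Rinv_0_lt_compat. lra.
Qed.

Lemma small_neq_1 u : (Cmod u < 1)%R -> 1 - u <> 0.
Proof.
  intros H E. assert (u = 1) by (symmetry; now apply Ceq_minus). subst u. rewrite Cmod_1 in H. lra.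
Qed.

Lemma Cminus_neq_0_sym (u v : C) : u - v <> 0 -> v - u <> 0.
Proof. intros N E. apply N. replace (u - v) with (- (v - u)) by ring. rewrite E. ring. Qed.

Lemma Cmod_1_minus u : (1 - Cmod u <= Cmod (1 - u))%R.
Proof.
  pose proof (Cmod_triangle (1 - u) u) as T. replace (1 - u + u) with (RtoC 1) in T by ring.
  rewrite Cmod_1 in T. lra.
Qed.

Lemma pfaff_small u : (Cmod u <= / 4)%R -> (Cmod (u / (u - 1)) < 1)%R.
Proof.
  intros H. pose proof (Cmod_1_minus u). pose proof (small_neq_1 u ltac:(lra)) as N.
  replace (u / (u - 1)) with (- (u / (1 - u))).
  - rewrite Cmod_opp, Cmod_div by exact N. apply Rlt_div_l; lra.
  - field. split; [now apply Cminus_neq_0_sym|exact N].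
Qed.

(** With [v = u/(u-1)], the factor [(1-u)^(-a) v^n] is
    [(-u)^n (1-u)^(-a-n)], a binomial series.  The coefficient of [u^k] in the
    resulting double series is a terminating sum that [chu_vandermonde] evaluates.
    For [|u| <= 1/4] the double series converges absolutely, with a majorant that is
    geometric of ratio [|u|/(1-|u|) <= 1/3]. *)
Lemma pfaff_local a b c u : ~ nonpos_int c -> (Cmod u <= / 4)%R ->
  Cseries (fun k => hyp2F1_coef a b c k * u ^ k)
    (binom a u * psum (hyp2F1_coef a (c - b) c) (u / (u - 1))).
Proof.
  intros Hc Hu.
  pose proof (Cmod_ge_0 u) as Hu0.
  assert (Hu1 : (Cmod u < 1)%R) by lra.
  pose proof (small_neq_1 u Hu1) as N.
  pose proof (Cminus_neq_0_sym _ _ N) as N'.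
  set (d := hyp2F1_coef a (c - b) c).
  set (t := Cmod u) in *.
  pose proof (Cmod_ge_0 a) as Ha.
  assert (HB : exists B, (0 <= B)%R /\ forall J, (bsum (Cmod a) t J <= B)%R).
  { assert (S0 : ex_series (fun j => Cmod (bcoef (Cmod a) j) * t ^ j)%R).
    { apply (subexp_series (fun n => Cmod (bcoef (Cmod a) n))); [lra|intros; apply Cmod_ge_0|apply subexp_bcoef]. }
    assert (P : forall J, (bsum (Cmod a) t J <= Series (fun j => Cmod (bcoef (Cmod a) j) * t ^ j))%R).
    { intros J. apply (sum_n_le_Series (fun j => Cmod (bcoef (Cmod a) j) * t ^ j)%R); [|exact S0].
      intros n. apply Rmult_le_pos; [apply Cmod_ge_0|apply pow_le; lra]. }
    eexists; split; [|exact P]. eapply Rle_trans; [|apply (P 0%nat)].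
    unfold bsum. rewrite sum_O, bcoef_0, Cmod_1. simpl. lra. }
  destruct HB as [B [HB0 HB]].
  assert (HI : (0 < / (1 - t))%R) by (apply Rinv_0_lt_compat; lra).
  (* Row [n] is the expansion of [d n * (-u)^n * (1-u)^(-a-n)]. *)
  apply (fubini (fun n k => d n * (- u) ^ n * shift (fun j => (bcoef (a + INR n) j * u ^ j)%C) n k)
    (fun n => binom a u * (d n * (u / (u - 1)) ^ n)) _ _
    (fun n => B * (Cmod (d n) * (t * / (1 - t)) ^ n))%R).
  - intros n K.
    assert (E : (sum_n (fun k => Cmod (d n * (- u) ^ n * shift (fun j => (bcoef (a + INR n) j * u ^ j)%C) n k)) K
       = Cmod (d n) * t ^ n * sum_n (fun k => Cmod (shift (fun j => (bcoef (a + INR n) j * u ^ j)%C) n k)) K :> R)%R).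
    { induction K.
      - rewrite !sum_O, !Cmod_mult, Cmod_pow, Cmod_opp. reflexivity.
      - rewrite !Rsum_S, IHK, !Cmod_mult, Cmod_pow, Cmod_opp. fold t. ring. }
    rewrite E.
    assert (Q : (sum_n (fun k => Cmod (shift (fun j => (bcoef (a + INR n) j * u ^ j)%C) n k)) K <= B * (/ (1 - t)) ^ n)%R).
    { apply shift_sum_bound.
      - apply Rmult_le_pos; [exact HB0|apply pow_le; lra].
      - intros J. apply (Rle_trans _ (bsum (Cmod a + INR n) t J)).
        + unfold bsum.
          assert (T : forall j, (Cmod (bcoef (a + INR n) j * u ^ j) <= Cmod (bcoef (Cmod a + INR n)%R j) * t ^ j)%R).
          { intros j. rewrite Cmod_coef. apply Rmult_le_compat_r; [apply pow_le; exact Hu0|].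
            apply bcoef_le. eapply Rle_trans; [apply Cmod_triangle|].
            rewrite Cmod_R, Rabs_pos_eq; [lra|apply pos_INR]. }
          clear - T. induction J; [rewrite !sum_O; apply T|]. rewrite !Rsum_S. specialize (T (S J)). lra.
        + eapply Rle_trans; [apply bsum_bound; lra|]. apply Rmult_le_compat_r; [apply pow_le; lra|apply HB]. }
    rewrite Rpow_mult_distr.
    replace (B * (Cmod (d n) * (t ^ n * (/ (1 - t)) ^ n)))%R with (Cmod (d n) * t ^ n * (B * (/ (1 - t)) ^ n))%R by ring.
    apply Rmult_le_compat_l; [|exact Q].
    apply Rmult_le_pos; [apply Cmod_ge_0|now apply pow_le].
  - apply (ex_series_scal_l B (fun n => Cmod (d n) * (t * / (1 - t)) ^ n)%R).
    apply (subexp_series (fun n => Cmod (d n))); [|intros; apply Cmod_ge_0|now apply subexp_hyp].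
    split; [apply Rmult_le_pos; lra|]. apply Rlt_div_l; lra.
  - intros n.
    replace (binom a u * (d n * (u / (u - 1)) ^ n)) with (d n * (- u) ^ n * binom (a + INR n) u).
    + apply Cseries_scal. apply Cseries_shift. now apply binom_correct.
    + rewrite (binom_shift a u n Hu1).
      replace (- u) with ((1 - u) * (u / (u - 1))) by (field; exact N').
      rewrite Cpow_mult_l. ring.
  - apply Cseries_scal. apply subexp_psum; [now apply subexp_hyp|]. now apply pfaff_small.
  - intros k.
    assert (E : hyp2F1_coef a b c k * u ^ k =
       Csum_n (fun n => d n * (- u) ^ n * shift (fun j => (bcoef (a + INR n) j * u ^ j)%C) n k) k).
    { rewrite hyp2F1_coef_bcoef by exact Hc. unfold bcoef at 1.
      replace (pochhammer a k * ifact k * (pochhammer b k / pochhammer c k) * u ^ k) with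
        (pochhammer a k * u ^ k * (pochhammer (c - (c - b)) k / pochhammer c k * ifact k)).
      2:{ replace (c - (c - b)) with b by ring. ring. }
      rewrite <- (chu_vandermonde (c - b) c k Hc). unfold binsum. rewrite <- Csum_scal.
      apply Csum_ext. intros n Hn. rewrite shift_ge by exact Hn.
      unfold d. rewrite hyp2F1_coef_bcoef by exact Hc. unfold bcoef.
      replace (pochhammer a k) with (pochhammer a n * pochhammer (a + INR n) (k - n)).
      2:{ rewrite <- pochhammer_add. f_equal. lia. }
      replace (u ^ k) with (u ^ n * u ^ (k - n)) by (rewrite <- Cpow_add_r; f_equal; lia).
      replace (- u) with (- (1) * u) by ring. rewrite Cpow_mult_l. ring. }
    rewrite E.
    apply (Cseries_finite (fun n => d n * (- u) ^ n * shift (fun j => (bcoef (a + INR n) j * u ^ j)%C) n k)).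
    intros n Hn. rewrite shift_lt by exact Hn. ring.
Qed.

(** [1 - u/(u-1) = 1/(1-u)].  In terms of series, this is the transformation for
    the first and third parameters equal to 1, where both Gauss series are binomial
    ones. *)
Lemma binom_pfaff a u : (Cmod u <= / 4)%R -> binom (- a) (u / (u - 1)) = binom a u.
Proof.
  intros Hu. pose proof (Cmod_ge_0 u) as Hu0.
  assert (Hu1 : (Cmod u < 1)%R) by lra.
  pose proof (small_neq_1 u Hu1) as N.
  pose proof (Cminus_neq_0_sym _ _ N) as N'.
  pose proof (pfaff_small u Hu) as Hv.
  assert (E1 : forall x n, hyp2F1_coef 1 x 1 n = bcoef x n).
  { intros x n. rewrite hyp2F1_coef_bcoef by apply one_not_nonpos. unfold bcoef. field.
    apply pochhammer_neq_0, one_not_nonpos. }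
  pose proof (pfaff_local 1 a 1 u one_not_nonpos Hu) as P.
  assert (E2 : psum (hyp2F1_coef 1 (1 - a) 1) (u / (u - 1)) = binom (1 - a) (u / (u - 1))).
  { apply (Cseries_unique (fun n => bcoef (1 - a) n * (u / (u - 1)) ^ n)).
    - apply (Cseries_ext (fun n => hyp2F1_coef 1 (1 - a) 1 n * (u / (u - 1)) ^ n)).
      + intros n. now rewrite E1.
      + apply subexp_psum; [apply subexp_hyp, one_not_nonpos|exact Hv].
    - now apply binom_correct. }
  rewrite E2 in P.
  assert (E3 : binom a u = binom 1 u * binom (1 - a) (u / (u - 1))).
  { apply (Cseries_unique (fun n => bcoef a n * u ^ n)); [now apply binom_correct|].
    eapply Cseries_ext; [|exact P]. intros n. simpl. now rewrite E1. }
  rewrite E3.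
  replace (- a) with (- (1) + (1 - a)) by ring.
  rewrite <- binom_mult, binom_m1 by exact Hv.
  f_equal.
  assert (Q : binom 1 u * (1 - u) = 1).
  { rewrite <- binom_m1, binom_mult by exact Hu1. replace (1 + - (1)) with (RtoC 0) by ring. now apply binom_0. }
  transitivity (/ (1 - u)); [field; auto|].
  transitivity (binom 1 u * (1 - u) * / (1 - u)); [rewrite Q; ring|field; exact N].
Qed.

(** [Re u < 1/2] says that [u] is closer to 0 than to 1. *)
Lemma Cmod_pfaff_lt u : (Re u < / 2)%R -> u - 1 <> 0 /\ (Cmod (u / (u - 1)) < 1)%R.
Proof.
  intros H.
  assert (N : u - 1 <> 0).
  { intros E. assert (u = 1) by now apply Ceq_minus. subst u. simpl in H. lra. }
  split; [exact N|]. rewrite Cmod_div by exact N.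
  assert (P : (0 < Cmod (u - 1))%R) by now apply Cmod_gt_0.
  apply Rlt_div_l; [exact P|]. rewrite Rmult_1_l.
  apply Rsqr_incrst_0; try apply Cmod_ge_0. rewrite !Rsqr_pow2, !Cmod2_alt.
  destruct u as [x y]. simpl in *. nra.
Qed.

(** The continuation exists on the half plane.  Agreement with the Gauss series is
    known near 0 and spreads to the whole part of the unit disc inside the half
    plane by the identity theorem. *)
Lemma is_hyp2F1_pfaff A B c w : ~ nonpos_int c -> (Re w < / 2)%R ->
  is_hyp2F1 A B c w (binom (- A) (w / (w - 1)) * psum (hyp2F1_coef A (c - B) c) (w / (w - 1))).
Proof.
  intros Hc Hw.
  set (f := fun u => binom (- A) (u / (u - 1)) * psum (hyp2F1_coef A (c - B) c) (u / (u - 1))).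
  assert (Hser : forall g, subexp (fun n => Cmod (g n)) ->
    forall rho, (0 <= rho < 1)%R -> ex_series (fun n => Cmod (g n) * rho ^ n)%R).
  { intros g Hg rho Hr. apply (subexp_series (fun n => Cmod (g n))); [exact Hr|intros; apply Cmod_ge_0|exact Hg]. }
  assert (Hf : forall u, (Re u < / 2)%R -> analytic_at f u).
  { intros u Hu. destruct (Cmod_pfaff_lt u Hu) as [N Hv].
    assert (An : analytic_at (fun u => u / (u - 1)) u).
    { apply analytic_at_pfaff. intros E. apply N. rewrite E. ring. }
    apply analytic_at_mult.
    - apply (analytic_at_comp (bcoef (- A)) (fun u => u / (u - 1)) u 1); [|exact Hv|exact An].
      apply Hser, subexp_bcoef.
    - apply (analytic_at_comp (hyp2F1_coef A (c - B) c) (fun u => u / (u - 1)) u 1); [|exact Hv|exact An].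
      apply Hser, subexp_hyp, Hc. }
  assert (Hstar : forall (u : C) (t : R), (Re u < / 2)%R -> (0 <= t <= 1)%R -> (Re (t * u) < / 2)%R).
  { intros u t Hu Ht. rewrite re_scal_l. destruct (Rle_lt_dec (Re u) 0); nra. }
  exists (fun u => (Re u < / 2)%R), f. split; [|split; [|split; [|split; [|split; [|split]]]]].
  - intros u Hu. apply Clocally_eps. exists (/ 2 - Re u)%R. split; [lra|].
    intros y Hy. pose proof (re_le_Cmod (y - u)) as R1.
    unfold Cminus in R1 at 1. rewrite re_plus, re_opp in R1.
    apply Rabs_le_between in R1. lra.
  - exact Hstar.
  - intros u Hu [_ H]. lra.
  - exact Hw.
  - apply analytic_at_on. exact Hf.
  - intros u Hu Hm. apply is_pseries_C.
    enough (f u = psum (hyp2F1_coef A B c) u) as ->.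
    { apply subexp_psum; [now apply subexp_hyp|exact Hm]. }
    apply Ceq_minus.
    apply (identity_theorem (fun u => (Re u < / 2)%R /\ (Cmod u < 1)%R)
      (fun u => f u - psum (hyp2F1_coef A B c) u) (/ 4)).
    + intros x t [H1 H2] Ht. split; [now apply Hstar|].
      rewrite Cmod_mult, Cmod_R, Rabs_pos_eq by lra. pose proof (Cmod_ge_0 x). nra.
    + intros x [H1 H2]. apply analytic_at_minus; [now apply Hf|].
      apply (analytic_at_comp (hyp2F1_coef A B c) (fun u => u) x 1); [|exact H2|apply analytic_at_id].
      apply Hser, subexp_hyp, Hc.
    + lra.
    + intros x _ Hx. apply (proj1 (Ceq_minus _ _)). unfold f. rewrite binom_pfaff by lra.
      apply (Cseries_unique (fun k => hyp2F1_coef A B c k * x ^ k)).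
      * apply pfaff_local; [exact Hc|lra].
      * apply subexp_psum; [now apply subexp_hyp|lra].
    + split; assumption.
  - reflexivity.
Qed.

Lemma hyp2F1_pfaff A B c w : ~ nonpos_int c -> (Re w < / 2)%R ->
  hyp2F1 A B c w = binom (- A) (w / (w - 1)) * psum (hyp2F1_coef A (c - B) c) (w / (w - 1)).
Proof.
  intros Hc Hw. apply Ciota_unique.
  - intros y Hy. eapply is_hyp2F1_unique; [exact Hy|now apply is_hyp2F1_pfaff].
  - now apply is_hyp2F1_pfaff.
Qed.

(** * The complex exponential and limits in the complex plane *)

Lemma Cexp_plus x y : Cexp (x + y) = Cexp x * Cexp y.
Proof.
  unfold Cexp. rewrite re_plus, im_plus, exp_plus, cos_plus, sin_plus.
  unfold Cmult; simpl. f_equal; ring.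
Qed.

Lemma Cexp_0 : Cexp 0 = 1.
Proof. unfold Cexp. simpl. rewrite exp_0, cos_0, sin_0. unfold RtoC. f_equal; ring. Qed.

Lemma Cexp_inv x : Cexp (- x) * Cexp x = 1.
Proof. rewrite <- Cexp_plus. replace (- x + x) with (RtoC 0) by ring. apply Cexp_0. Qed.

Lemma Cexp_neq_0 x : Cexp x <> 0.
Proof. intros E. apply C1_nz. rewrite <- (Cexp_inv x), E. ring. Qed.

Lemma Cexp_real (x : R) : Cexp x = RtoC (exp x).
Proof. unfold Cexp, RtoC. simpl. rewrite cos_0, sin_0. f_equal; ring. Qed.

Lemma sin_taylor q : (Rabs q <= / 2)%R -> (Rabs (sin q - q) <= q ^ 2)%R.
Proof.
  assert (P : forall q, (0 <= q <= / 2)%R -> (Rabs (sin q - q) <= q ^ 2)%R).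
  { clear q. intros q Hq.
    destruct (pre_sin_bound q 0 ltac:(lra) ltac:(lra)) as [L U].
    unfold sin_approx, sin_term in L, U. simpl in L, U. apply Rabs_le.
    split.
    - assert (q * q * q <= q * q)%R by nra. nra.
    - assert (q * q * q <= q * q)%R by nra. assert (0 <= q * q * q)%R by nra.
      assert (q * q * q * (q * q) <= q * q * q)%R by nra. nra. }
  intros H. destruct (Rle_lt_dec 0 q).
  - apply P. rewrite Rabs_pos_eq in H; lra.
  - rewrite Rabs_left in H by lra. specialize (P (- q)%R ltac:(lra)).
    rewrite sin_neg in P. replace (- sin q - - q)%R with (- (sin q - q))%R in P by ring.
    rewrite Rabs_Ropp in P. nra.
Qed.

Lemma cos_taylor q : (Rabs q <= / 2)%R -> (Rabs (cos q - 1) <= q ^ 2)%R.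
Proof.
  intros H.
  assert (H2 : (Rabs (q / 2) <= / 2)%R).
  { unfold Rdiv. rewrite Rabs_mult, (Rabs_pos_eq (/ 2)) by lra. pose proof (Rabs_pos q). lra. }
  pose proof (sin_taylor _ H2) as S.
  replace (cos q - 1)%R with (- (2 * (sin (q / 2)) ^ 2))%R.
  2:{ replace q with (2 * (q / 2))%R at 2 by field. rewrite cos_2a_sin. ring. }
  rewrite Rabs_Ropp, Rabs_pos_eq by (pose proof (pow2_ge_0 (sin (q / 2))); lra).
  apply Rabs_le_between in S.
  apply Rabs_le_between in H.
  assert ((q / 2) ^ 2 <= / 8 * Rabs q)%R as S2.
  { unfold Rabs. destruct (Rcase_abs q); nra. }
  assert (Rabs (sin (q / 2)) <= / 2 * Rabs q + / 8 * Rabs q)%R as S3.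
  { unfold Rabs in S2 |- *. destruct (Rcase_abs q), (Rcase_abs (sin (q / 2))); lra. }
  rewrite <- (pow2_abs (sin (q / 2))), <- (pow2_abs q).
  pose proof (Rabs_pos (sin (q / 2))). pose proof (Rabs_pos q).
  assert (Rabs (sin (q / 2)) ^ 2 <= (5 / 8 * Rabs q) ^ 2)%R as S4 by (apply pow_incr; lra).
  nra.
Qed.

Lemma exp_taylor p : (Rabs p <= / 2)%R -> (0 <= exp p - 1 - p <= 2 * p ^ 2)%R.
Proof.
  intros H. apply Rabs_le_between in H. split.
  - pose proof (exp_ineq1_le p). lra.
  - pose proof (exp_ineq1_le (- p)) as E. rewrite exp_Ropp in E.
    pose proof (exp_pos p) as P.
    apply (Rmult_le_compat_r (exp p)) in E; [|lra]. rewrite Rinv_l in E by lra.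
    assert (exp p * (1 - p) <= (1 + p + 2 * p ^ 2) * (1 - p))%R; [|nra].
    assert (0 <= p ^ 2 * (1 - 2 * p))%R by (apply Rmult_le_pos; [apply pow2_ge_0|lra]). nra.
Qed.

Lemma Cmod_le_sum x : (Cmod x <= Rabs (Re x) + Rabs (Im x))%R.
Proof.
  pose proof (Rabs_pos (Re x)). pose proof (Rabs_pos (Im x)).
  apply Rsqr_incr_0; [|apply Cmod_ge_0|lra].
  rewrite !Rsqr_pow2, Cmod2_alt, <- (pow2_abs (Re x)), <- (pow2_abs (Im x)). nra.
Qed.

Lemma Cexp_taylor y : (Cmod y <= / 2)%R -> (Cmod (Cexp y - 1 - y) <= 8 * Cmod y ^ 2)%R.
Proof.
  intros H. rewrite Cmod2_alt.
  assert (Hp : (Rabs (Re y) <= / 2)%R) by (eapply Rle_trans; [apply re_le_Cmod|exact H]).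
  assert (Hq : (Rabs (Im y) <= / 2)%R).
  { eapply Rle_trans; [|exact H]. eapply Rle_trans; [|apply Rmax_Cmod]. apply Rmax_r. }
  eapply Rle_trans; [apply Cmod_le_sum|].
  destruct y as [p q]. unfold Cexp, Cminus, Cplus, Copp. simpl in *.
  replace (exp p * cos q + - (1) + - p)%R with (exp p * (cos q - 1) + (exp p - 1 - p))%R by ring.
  replace (exp p * sin q + -0 + - q)%R with (exp p * (sin q - q) + (exp p - 1) * q)%R by ring.
  pose proof (exp_taylor p Hp) as E. pose proof (cos_taylor q Hq) as Ec. pose proof (sin_taylor q Hq) as Es.
  assert (Hp2 : (p ^ 2 <= / 2 * Rabs p)%R).
  { rewrite <- pow2_abs. pose proof (Rabs_pos p). nra. }
  assert (E1 : (Rabs (exp p - 1) <= 2 * Rabs p)%R).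
  { clear Ec Es Hq H. apply Rabs_le. revert Hp Hp2. unfold Rabs. destruct (Rcase_abs p); intros; lra. }
  assert (E2 : (exp p <= 2)%R) by (apply Rabs_le_between in E1; lra).
  pose proof (exp_pos p) as E0.
  assert (A1 : (Rabs (exp p * (cos q - 1) + (exp p - 1 - p)) <= 2 * q ^ 2 + 2 * p ^ 2)%R).
  { eapply Rle_trans; [apply Rabs_triang|].
    rewrite Rabs_mult, (Rabs_pos_eq (exp p)), (Rabs_pos_eq (exp p - 1 - p)) by lra.
    pose proof (Rabs_pos (cos q - 1)). nra. }
  assert (A2 : (Rabs (exp p * (sin q - q) + (exp p - 1) * q) <= 2 * q ^ 2 + 2 * Rabs p * Rabs q)%R).
  { eapply Rle_trans; [apply Rabs_triang|].
    rewrite !Rabs_mult, (Rabs_pos_eq (exp p)) by lra.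
    pose proof (Rabs_pos (sin q - q)). pose proof (Rabs_pos q). nra. }
  assert (A3 : (2 * Rabs p * Rabs q <= p ^ 2 + q ^ 2)%R).
  { rewrite <- (pow2_abs p), <- (pow2_abs q). pose proof (pow2_ge_0 (Rabs p - Rabs q)). lra. }
  pose proof (pow2_ge_0 p). pose proof (pow2_ge_0 q). simpl in *. lra.
Qed.

Lemma Clim_const {T} (F : (T -> Prop) -> Prop) {FF : Filter F} (c : C) :
  filterlim (fun _ : T => c) F (locally c).
Proof.
  apply Clim_eps; [exact FF|]. intros e He. apply filter_forall. intros _.
  replace (c - c) with (RtoC 0) by ring. rewrite Cmod_0. exact He.
Qed.

Lemma Clim_val {T} (F : (T -> Prop) -> Prop) (f : T -> C) (l m : C) :
  l = m -> filterlim f F (locally l) -> filterlim f F (locally m).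
Proof. now intros ->. Qed.

Lemma Clim_id (c : C) : filterlim (fun x : C => x) (locally c) (locally c).
Proof. apply filterlim_id. Qed.

Lemma Clim_plus {T} (F : (T -> Prop) -> Prop) {FF : Filter F} (f g : T -> C) (l m : C) :
  filterlim f F (locally l) -> filterlim g F (locally m) ->
  filterlim (fun x => f x + g x) F (locally (l + m)).
Proof.
  intros Hf Hg. refine (filterlim_comp_2 _ _ Cplus Hf Hg _).
  exact (filterlim_plus (V := C_NormedModule) l m).
Qed.

Lemma Clim_mult {T} (F : (T -> Prop) -> Prop) {FF : Filter F} (f g : T -> C) (l m : C) :
  filterlim f F (locally l) -> filterlim g F (locally m) ->
  filterlim (fun x => f x * g x) F (locally (l * m)).
Proof.
  rewrite !Clim_eps by exact FF. intros Hf Hg e He.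
  pose proof (Cmod_ge_0 l). pose proof (Cmod_ge_0 m).
  set (d := Rmin 1 (e / (1 + Cmod l + Cmod m))).
  assert (Hd : (0 < d)%R) by (apply Rmin_pos; [lra|apply Rdiv_lt_0_compat; lra]).
  assert (Hd1 : (d <= 1)%R) by apply Rmin_l.
  assert (Hd2 : (d * (1 + Cmod l + Cmod m) <= e)%R).
  { apply Rle_div_r; [lra|apply Rmin_r]. }
  generalize (filter_and _ _ (Hf d Hd) (Hg d Hd)). apply filter_imp. intros x [A B].
  replace (f x * g x - l * m) with ((f x - l) * (g x - m) + (l * (g x - m) + m * (f x - l))) by ring.
  eapply Rle_lt_trans; [apply Cmod_triangle|].
  eapply Rle_lt_trans; [apply Rplus_le_compat_l, Cmod_triangle|].
  rewrite !Cmod_mult. pose proof (Cmod_ge_0 (f x - l)). pose proof (Cmod_ge_0 (g x - m)).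
  assert (Cmod (f x - l) * Cmod (g x - m) < d * 1)%R by nra.
  nra.
Qed.

Lemma Clim_inv {T} (F : (T -> Prop) -> Prop) {FF : Filter F} (f : T -> C) (l : C) : l <> 0 ->
  filterlim f F (locally l) -> filterlim (fun x => / f x) F (locally (/ l)).
Proof.
  rewrite !Clim_eps by exact FF. intros Hl Hf e He.
  assert (P : (0 < Cmod l)%R) by now apply Cmod_gt_0.
  set (d := Rmin (Cmod l / 2) (e * (Cmod l * (Cmod l / 2)))).
  assert (P2 : (0 < Cmod l * (Cmod l / 2))%R) by (apply Rmult_lt_0_compat; lra).
  assert (Hd : (0 < d)%R) by (apply Rmin_pos; [lra|now apply Rmult_lt_0_compat]).
  pose proof (Rmin_l (Cmod l / 2) (e * (Cmod l * (Cmod l / 2)))) as D1.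
  pose proof (Rmin_r (Cmod l / 2) (e * (Cmod l * (Cmod l / 2)))) as D2.
  fold d in D1, D2.
  generalize (Hf d Hd). apply filter_imp. intros x A.
  assert (B : (Cmod l / 2 < Cmod (f x))%R).
  { pose proof (Cmod_triangle (f x) (- (f x - l))) as T0.
    replace (f x + - (f x - l)) with l in T0 by ring. rewrite Cmod_opp in T0. lra. }
  assert (N : f x <> 0) by (apply Cmod_gt_0; lra).
  replace (/ f x - / l) with (- (f x - l) / (f x * l)) by (field; auto).
  rewrite Cmod_div by now apply Cmult_neq_0. rewrite Cmod_opp, Cmod_mult.
  apply Rlt_div_l; [apply Rmult_lt_0_compat; lra|].
  eapply Rlt_le_trans; [exact A|]. eapply Rle_trans; [exact D2|].
  apply Rmult_le_compat_l; [lra|]. rewrite (Rmult_comm (Cmod (f x))). apply Rmult_le_compat_l; lra.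
Qed.

Lemma Ccont_Cexp (y : C) : filterlim Cexp (locally y) (locally (Cexp y)).
Proof.
  apply (filterlim_ext (fun x => Cexp y * (1 + (Cexp (x + - y) + - (1))))).
  { intros x. replace x with (y + (x + - y)) at 2 by ring. rewrite (Cexp_plus y (x + - y)). ring. }
  apply (Clim_val _ _ (Cexp y * (1 + 0))); [ring|].
  apply (Clim_mult (locally y)); [apply Clim_const; apply locally_filter|].
  apply Clim_plus; [apply locally_filter|apply Clim_const; apply locally_filter|].
  apply Clim_eps; [apply locally_filter|]. intros e He.
  apply Clocally_eps. exists (Rmin (/ 2) (e / 5)). split; [apply Rmin_pos; lra|].
  intros x Hx. pose proof (Rmin_l (/ 2) (e / 5)). pose proof (Rmin_r (/ 2) (e / 5)).
  unfold Cminus in Hx. set (h := x + - y) in *.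
  pose proof (Cexp_taylor h ltac:(lra)) as T1. pose proof (Cmod_ge_0 h).
  replace (Cexp h + - (1) - 0) with ((Cexp h - 1 - h) + h) by ring.
  eapply Rle_lt_trans; [apply Cmod_triangle|].
  assert (8 * Cmod h ^ 2 <= 4 * Cmod h)%R by nra. lra.
Qed.

(** * The reciprocal of the Gamma function *)

(** The reciprocal of Gauss's approximation [n! n^s / (s)_(n+1)]: unlike the latter
    it is defined for every [s]. *)
Definition rgauss (n : nat) (s : C) : C := pochhammer s (S n) * ifact n * Rcpow (INR n) (- s).

(** The relative increment of [rgauss] from [m+1] to [m+2]. *)
Definition rstep (m : nat) (s : C) : C :=
  (1 + s / INR (S (S m))) * Cexp (- s * ln (INR (S (S m)) / INR (S m))) - 1.

Lemma rgauss_step m s : rgauss (S (S m)) s = rgauss (S m) s * (1 + rstep m s).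
Proof.
  unfold rgauss, rstep.
  assert (E : Rcpow (INR (S (S m))) (- s) =
     Rcpow (INR (S m)) (- s) * Cexp (- s * ln (INR (S (S m)) / INR (S m)))).
  { unfold Rcpow. rewrite <- Cexp_plus. f_equal.
    assert (0 < INR (S m))%R by (apply lt_0_INR; lia).
    assert (0 < INR (S (S m)))%R by (apply lt_0_INR; lia).
    rewrite ln_div by assumption. rewrite RtoC_minus. ring. }
  rewrite E, (pochhammer_S s (S (S m))), <- (ifact_S (S m)).
  field. intros Z. apply RtoC_inj in Z. revert Z. apply not_0_INR. lia.
Qed.

(** Inverse products of consecutive integers, a summable sequence of order [1/m^2]
    with telescoping sum. *)
Definition tau (m : nat) : R := (/ (INR (S m) * INR (S (S m))))%R.

Lemma INR_S_pos m : (0 < INR (S m))%R.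
Proof. apply lt_0_INR. lia. Qed.

Lemma tau_pos m : (0 < tau m)%R.
Proof. apply Rinv_0_lt_compat, Rmult_lt_0_compat; apply INR_S_pos. Qed.

Lemma tau_sum K : (sum_n tau K <= 1)%R.
Proof.
  assert (E : (sum_n tau K = 1 - / INR (S (S K)) :> R)%R).
  { induction K.
    - rewrite sum_O. unfold tau. simpl. lra.
    - rewrite Rsum_S, IHK. unfold tau.
      pose proof (INR_S_pos (S K)). rewrite (S_INR (S (S K))). field. lra. }
  rewrite E. pose proof (Rinv_0_lt_compat _ (INR_S_pos (S K))). lra.
Qed.

Lemma ex_series_tau : ex_series tau.
Proof. apply (ex_series_pos_bounded tau 1); [intros; left; apply tau_pos|apply tau_sum]. Qed.

(** The terms of first order in [s] are [s/(x+1)] and [-s ln(1+1/x)] with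
    [x = m+1]; both are [s/x] up to [O(1/x^2)], so they cancel to that order. *)
Lemma rstep_bound rho : (0 <= rho)%R -> exists K N, (0 <= K)%R /\
  forall s m, (Cmod s <= rho)%R -> (N <= m)%nat -> (Cmod (rstep m s) <= K * tau m)%R.
Proof.
  intros Hr. destruct (INR_unbounded (2 * rho)) as [N HN].
  exists (rho + rho ^ 2 + (1 + rho) * (16 * rho ^ 2))%R, N.
  split; [pose proof (pow2_ge_0 rho); nra|].
  intros s m Hs Hm.
  assert (Hx : (2 * rho <= INR (S m))%R).
  { rewrite S_INR. apply le_INR in Hm. lra. }
  unfold rstep, tau. pose proof (INR_S_pos m) as X0.
  assert (X1 : (1 <= INR (S m))%R) by (rewrite S_INR; pose proof (pos_INR m); lra).
  rewrite (S_INR (S m)). set (x := INR (S m)) in *.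
  set (e := (/ (x + 1))%R). set (L := ln ((x + 1) / x)).
  assert (He : (0 < e <= 1)%R).
  { unfold e. split; [apply Rinv_0_lt_compat; lra|]. rewrite <- Rinv_1. apply Rinv_le_contravar; lra. }
  assert (Q : (0 < (x + 1) / x)%R) by (apply Rdiv_lt_0_compat; lra).
  assert (L1 : (L <= / x)%R).
  { pose proof (exp_ineq1_le L) as T. unfold L in T. rewrite exp_ln in T by exact Q. fold L in T.
    replace ((x + 1) / x)%R with (1 + / x)%R in T by (field; lra). lra. }
  assert (L2 : (e <= L)%R).
  { pose proof (exp_ineq1_le (- L)) as T. unfold L in T. rewrite exp_Ropp, exp_ln in T by exact Q. fold L in T.
    replace (/ ((x + 1) / x))%R with (1 - e)%R in T by (unfold e; field; lra). lra. }
  assert (Ht : (/ (x * (x + 1)) = / x - e)%R) by (unfold e; field; lra).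
  assert (Ht2 : (/ (x * (x + 1)) = / x * e)%R) by (unfold e; field; lra).
  assert (Hix : (0 < / x)%R) by (apply Rinv_0_lt_compat; lra).
  assert (Hix2 : (/ x * / x <= 2 * / (x * (x + 1)))%R).
  { rewrite Ht2. assert (/ x <= 2 * e)%R; [|nra]. unfold e.
    apply (Rmult_le_reg_r (x * (x + 1))); [nra|].
    replace (/ x * (x * (x + 1)))%R with (x + 1)%R by (field; lra).
    replace (2 * / (x + 1) * (x * (x + 1)))%R with (2 * x)%R by (field; lra). lra. }
  set (t := (/ (x * (x + 1)))%R) in *.
  set (y := - s * L).
  assert (Hy0 : (Cmod y <= rho * / x)%R).
  { unfold y. rewrite Cmod_mult, Cmod_opp, Cmod_R, Rabs_pos_eq by lra.
    apply Rmult_le_compat; [apply Cmod_ge_0|lra|exact Hs|exact L1]. }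
  assert (Hy : (Cmod y <= / 2)%R).
  { eapply Rle_trans; [exact Hy0|]. apply (Rmult_le_reg_r x); [lra|].
    rewrite Rmult_assoc, Rinv_l by lra. lra. }
  pose proof (Cexp_taylor y Hy) as T. set (r := Cexp y - 1 - y) in *.
  assert (Hr2 : (Cmod r <= 16 * rho ^ 2 * t)%R).
  { eapply Rle_trans; [exact T|].
    assert (Cmod y ^ 2 <= (rho * / x) ^ 2)%R by (apply pow_incr; split; [apply Cmod_ge_0|exact Hy0]).
    replace ((rho * / x) ^ 2)%R with (rho ^ 2 * (/ x * / x))%R in H by ring.
    pose proof (pow2_ge_0 rho). nra. }
  assert (Exp : Cexp y = 1 + y + r) by (unfold r; ring).
  rewrite Exp.
  assert (Ee : s / RtoC (x + 1)%R = s * RtoC e).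
  { unfold e, Cdiv. rewrite RtoC_inv by lra. reflexivity. }
  rewrite Ee.
  (* The first summand collects the first-order terms, which nearly cancel. *)
  replace ((1 + s * e) * (1 + y + r) - 1) with
    ((s * (e - L)%R + s * s * (- (e * L))%R) + (1 + s * e) * r).
  2:{ unfold y. rewrite RtoC_minus, RtoC_opp, RtoC_mult. ring. }
  pose proof (Cmod_ge_0 s) as Hs0. pose proof (Cmod_ge_0 r) as Hr0.
  eapply Rle_trans; [apply Cmod_triangle|].
  replace ((rho + rho ^ 2 + (1 + rho) * (16 * rho ^ 2)) * t)%R with
    ((rho * t + rho ^ 2 * t) + (1 + rho) * (16 * rho ^ 2 * t))%R by ring.
  apply Rplus_le_compat.
  - eapply Rle_trans; [apply Cmod_triangle|]. rewrite !Cmod_mult, !Cmod_R, Rabs_Ropp.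
    rewrite (Rabs_left1 (e - L)) by lra. rewrite (Rabs_pos_eq (e * L)) by nra.
    apply Rplus_le_compat.
    + apply Rmult_le_compat; lra.
    + replace (rho ^ 2)%R with (rho * rho)%R by ring. apply Rmult_le_compat; [nra|nra|nra|].
      rewrite Ht2, (Rmult_comm e). apply Rmult_le_compat; lra.
  - rewrite Cmod_mult.
    assert (A : (Cmod (1 + s * e) <= 1 + rho)%R).
    { eapply Rle_trans; [apply Cmod_triangle|]. rewrite Cmod_1, Cmod_mult, Cmod_R, Rabs_pos_eq by lra. nra. }
    apply Rmult_le_compat; auto. apply Cmod_ge_0.
Qed.

Lemma product_bound (u b : nat -> R) B : (0 <= u 0%nat)%R -> (forall k, 0 <= b k)%R ->
  (forall k, u (S k) <= u k * (1 + b k))%R -> (forall K, sum_n b K <= B)%R ->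
  forall k, (u k <= u 0%nat * exp B)%R.
Proof.
  intros H0 Hb Hu HB k.
  assert (HB0 : (0 <= B)%R).
  { eapply Rle_trans; [|apply (HB 0%nat)]. rewrite sum_O. apply Hb. }
  destruct k.
  - rewrite <- (Rmult_1_r (u 0%nat)) at 1. apply Rmult_le_compat_l; [exact H0|].
    pose proof (exp_ineq1_le B). lra.
  - apply (Rle_trans _ (u 0%nat * exp (sum_n b k))).
    + induction k.
      * rewrite sum_O. eapply Rle_trans; [apply Hu|]. apply Rmult_le_compat_l; [exact H0|apply exp_ineq1_le].
      * rewrite Rsum_S, exp_plus, <- Rmult_assoc.
        eapply Rle_trans; [apply Hu|]. specialize (Hb (S k)).
        pose proof (exp_ineq1_le (b (S k))). pose proof (exp_pos (sum_n b k)).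
        apply (Rle_trans _ (u 0%nat * exp (sum_n b k) * (1 + b (S k)))).
        { apply Rmult_le_compat_r; [lra|exact IHk]. }
        apply Rmult_le_compat_l; [nra|lra].
    + apply Rmult_le_compat_l; [exact H0|].
      destruct (HB k) as [Hl|He]; [left; now apply exp_increasing|right; now rewrite He].
Qed.

Lemma tau_shift_sum K c N : (0 <= c)%R -> (sum_n (fun k => c * tau (N + k)%nat) K <= c)%R.
Proof.
  intros Hc.
  assert (E : forall K, (sum_n (fun k => c * tau (N + k)%nat) K <= c * sum_n tau (N + K)%nat)%R).
  { clear K. induction K.
    - rewrite sum_O, Nat.add_0_r. apply Rmult_le_compat_l; [exact Hc|].
      apply (sum_n_ge_term tau). intros; left; apply tau_pos.
    - rewrite Rsum_S, Nat.add_succ_r, Rsum_S. lra. }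
  eapply Rle_trans; [apply E|]. pose proof (tau_sum (N + K)). nra.
Qed.

(** Writing the limit of [rgauss] as a telescoping series makes it accessible to
    dominated convergence in [s]. *)
Definition rterm (s : C) (k : nat) : C :=
  match k with O => rgauss 1 s | S k => rgauss (S (S k)) s - rgauss (S k) s end.

(** The entire function [1/Gamma]. *)
Definition rGamma (s : C) : C := CSum (rterm s).

Lemma rterm_sum s k : Csum_n (rterm s) k = rgauss (S k) s.
Proof.
  induction k; [apply Csum_0|]. rewrite Csum_S, IHk. simpl. ring.
Qed.

(** For bounded [s] the products from [N] on are bounded by a constant times their
    first factor, so the increments are of order [1/k^2] uniformly in [s]. *)
Lemma rgauss_bound rho : (0 <= rho)%R -> exists K N, (0 <= K)%R /\
  forall s k, (Cmod s <= rho)%R -> (N <= k)%nat ->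
  (Cmod (rterm s (S k)) <= Cmod (rgauss (S N) s) * K * tau k)%R.
Proof.
  intros Hr. destruct (rstep_bound rho Hr) as [K [N [HK H]]].
  exists (exp K * K)%R, N. split; [pose proof (exp_pos K); nra|].
  intros s k Hs Hk.
  assert (B : (Cmod (rgauss (S k) s) <= Cmod (rgauss (S N) s) * exp K)%R).
  { pose proof (product_bound (fun j => Cmod (rgauss (S (N + j)) s)) (fun j => K * tau (N + j)%nat)%R K) as P.
    cbv beta in P. rewrite Nat.add_0_r in P.
    replace k with (N + (k - N))%nat by lia. apply P.
    - apply Cmod_ge_0.
    - intros j. pose proof (tau_pos (N + j)). nra.
    - intros j. rewrite Nat.add_succ_r, rgauss_step, Cmod_mult.
      apply Rmult_le_compat_l; [apply Cmod_ge_0|].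
      eapply Rle_trans; [apply Cmod_triangle|]. rewrite Cmod_1.
      specialize (H s (N + j)%nat Hs ltac:(lia)). lra.
    - intros J. now apply tau_shift_sum. }
  simpl. rewrite rgauss_step.
  replace (rgauss (S k) s * (1 + rstep k s) - rgauss (S k) s) with (rgauss (S k) s * rstep k s) by ring.
  rewrite Cmod_mult. specialize (H s k Hs Hk).
  replace (Cmod (rgauss (S N) s) * (exp K * K) * tau k)%R with
    ((Cmod (rgauss (S N) s) * exp K) * (K * tau k))%R by ring.
  apply Rmult_le_compat; auto; apply Cmod_ge_0.
Qed.

Definition rmajor (B : R) (k : nat) : R := match k with O => 0%R | S k => (B * tau k)%R end.

Lemma ex_series_rmajor B : ex_series (rmajor B).
Proof.
  apply (proj2 (ex_series_incr_1 (V := R_NormedModule) (rmajor B))).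
  apply (ex_series_scal_l B tau), ex_series_tau.
Qed.

Lemma rGamma_correct s : Cseries (rterm s) (rGamma s).
Proof.
  destruct (rgauss_bound (Cmod s) (Cmod_ge_0 s)) as [K [N [HK H]]].
  apply (CSum_dominated_from _ (rmajor (Cmod (rgauss (S N) s) * K)) (S N)); [|apply ex_series_rmajor].
  intros [|n] Hn; [lia|]. apply H; [lra|lia].
Qed.

Lemma rgauss_lim s : filterlim (fun n => rgauss n s) eventually (locally (rGamma s)).
Proof.
  pose proof (rGamma_correct s) as H. apply Cseries_def in H.
  apply Clim_eps; [apply eventually_filter|]. intros e He.
  destruct (proj1 (Clim_eps eventually _ _) H e He) as [N HN].
  exists (S N). intros [|n] Hn; [lia|]. rewrite <- rterm_sum. apply HN. lia.
Qed.

Lemma Ccont_pochhammer n s : filterlim (fun x => pochhammer x n) (locally s) (locally (pochhammer s n)).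
Proof.
  induction n.
  - exact (Clim_const (locally s) (RtoC 1)).
  - apply (Clim_mult (locally s)); [exact IHn|].
    apply Clim_plus; [apply locally_filter|apply Clim_id|apply Clim_const, locally_filter].
Qed.

Lemma Ccont_rgauss n s : filterlim (rgauss n) (locally s) (locally (rgauss n s)).
Proof.
  apply Clim_mult; [apply locally_filter|apply Clim_mult; [apply locally_filter|apply Ccont_pochhammer|apply Clim_const, locally_filter]|].
  unfold Rcpow.
  eapply filterlim_comp; [|apply Ccont_Cexp].
  apply (filterlim_ext (fun x => (- (1) * ln (INR n)) * x)); [intros; ring|].
  replace (- s * ln (INR n)) with ((- (1) * ln (INR n)) * s) by ring.
  apply Clim_mult; [apply locally_filter|apply Clim_const, locally_filter|apply Clim_id].
Qed.

Lemma Ccont_rGamma s : filterlim rGamma (locally s) (locally (rGamma s)).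
Proof.
  pose proof (Cmod_ge_0 s) as Hs.
  destruct (rgauss_bound (Cmod s + 1) ltac:(lra)) as [K [N [HK H]]].
  apply (tannery (locally s) rterm rGamma (rterm s) _ (rmajor ((Cmod (rgauss (S N) s) + 1) * K)) (S N)).
  - intros [|n].
    + apply Ccont_rgauss.
    + simpl. apply (filterlim_ext (fun x => rgauss (S (S n)) x + - (1) * rgauss (S n) x)); [intros; ring|].
      replace (rgauss (S (S n)) s - rgauss (S n) s) with (rgauss (S (S n)) s + - (1) * rgauss (S n) s) by ring.
      apply Clim_plus; [apply locally_filter|apply Ccont_rgauss|].
      apply Clim_mult; [apply locally_filter|apply Clim_const, locally_filter|apply Ccont_rgauss].
  - apply ex_series_rmajor.
  - pose proof (proj1 (Clim_eps (locally s) _ _) (Ccont_rgauss (S N) s) 1%R Rlt_0_1) as A.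
    assert (B : locally s (fun x => (Cmod (x - s) < 1)%R)).
    { apply Clocally_eps. exists 1%R. split; [lra|auto]. }
    generalize (filter_and _ _ A B). apply filter_imp. intros x [Hx1 Hx2] [|n] Hn; [lia|].
    assert (Hx : (Cmod x <= Cmod s + 1)%R).
    { replace x with (s + (x - s)) by ring. eapply Rle_trans; [apply Cmod_triangle|]. lra. }
    eapply Rle_trans; [apply H; [exact Hx|lia]|]. simpl.
    apply Rmult_le_compat_r; [left; apply tau_pos|]. apply Rmult_le_compat_r; [exact HK|].
    replace (rgauss (S N) x) with (rgauss (S N) s + (rgauss (S N) x - rgauss (S N) s)) by ring.
    eapply Rle_trans; [apply Cmod_triangle|]. lra.
  - apply filter_forall. intros x. apply rGamma_correct.
  - apply rGamma_correct.
Qed.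

Lemma inv_INR_lim : filterlim (fun n => RtoC (/ INR n)) eventually (locally (RtoC 0)).
Proof.
  apply Clim_eps; [apply eventually_filter|]. intros e He.
  destruct (INR_unbounded (/ e)) as [N HN]. exists N. intros n Hn.
  apply le_INR in Hn. pose proof (Rinv_0_lt_compat e He).
  rewrite <- RtoC_minus, Rminus_0_r, Cmod_R, Rabs_pos_eq.
  - rewrite <- (Rinv_inv e). apply Rinv_lt_contravar; [nra|lra].
  - left. apply Rinv_0_lt_compat. lra.
Qed.

Lemma filterlim_C_unique {T} (F : (T -> Prop) -> Prop) {FF : ProperFilter F} (f : T -> C) (l m : C) :
  filterlim f F (locally l) -> filterlim f F (locally m) -> l = m.
Proof. exact (@filterlim_locally_unique T C_AbsRing C_NormedModule F _ f l m). Qed.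

Lemma Rcpow_opp1 n : (0 < n)%nat -> Rcpow (INR n) (- (1)) = RtoC (/ INR n).
Proof.
  intros H. unfold Rcpow. rewrite <- RtoC_opp, <- RtoC_mult, Cexp_real.
  f_equal. replace (- (1) * ln (INR n))%R with (- ln (INR n))%R by ring.
  rewrite exp_Ropp, exp_ln; [reflexivity|]. now apply lt_0_INR.
Qed.

Lemma rGamma_shift s : rGamma s = s * rGamma (s + 1).
Proof.
  apply (filterlim_C_unique eventually (fun n => rgauss n s * (1 + (s + 1) * RtoC (/ INR n)))).
  - replace (rGamma s) with (rGamma s * (1 + (s + 1) * 0)) by ring.
    apply Clim_mult; [typeclasses eauto|apply rgauss_lim|].
    apply Clim_plus; [typeclasses eauto|apply Clim_const; typeclasses eauto|].
    apply Clim_mult; [typeclasses eauto|apply Clim_const; typeclasses eauto|apply inv_INR_lim].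
  - apply (filterlim_ext_loc (fun n => s * rgauss n (s + 1))).
    + exists 1%nat. intros n Hn. unfold rgauss.
      rewrite (pochhammer_S (s + 1)).
      replace (s * (pochhammer (s + 1) n * (s + 1 + INR n) * ifact n * Rcpow (INR n) (- (s + 1)))) with
        ((s * pochhammer (s + 1) n) * (s + 1 + INR n) * ifact n * Rcpow (INR n) (- (s + 1))) by ring.
      rewrite <- pochhammer_first.
      assert (E : Rcpow (INR n) (- (s + 1)) = Rcpow (INR n) (- s) * RtoC (/ INR n)).
      { rewrite <- (Rcpow_opp1 n) by lia. unfold Rcpow. rewrite <- Cexp_plus. f_equal. ring. }
      rewrite E. rewrite RtoC_inv by (apply not_0_INR; lia). field.
      intros Z. apply RtoC_inj in Z. revert Z. apply not_0_INR. lia.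
    + apply Clim_mult; [typeclasses eauto|apply Clim_const; typeclasses eauto|apply rgauss_lim].
Qed.

Lemma rGamma_pochhammer s n : rGamma s = pochhammer s n * rGamma (s + INR n).
Proof.
  induction n.
  - simpl. replace (s + 0) with s by ring. ring.
  - rewrite IHn, (rGamma_shift (s + INR n)), pochhammer_S, INR_S_C.
    replace (s + (INR n + 1)) with (s + INR n + 1) by ring. ring.
Qed.

Lemma Rcpow_neq_0 r s : Rcpow r s <> 0.
Proof. apply Cexp_neq_0. Qed.

Lemma rgauss_neq_0 n s : ~ nonpos_int s -> rgauss n s <> 0.
Proof.
  intros H. unfold rgauss. apply Cmult_neq_0; [|apply Rcpow_neq_0].
  apply Cmult_neq_0; [now apply pochhammer_neq_0|].
  intros E. apply C1_nz. rewrite <- (Cinv_l (INR (fact n)) (fact_C_neq_0 n)).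
  unfold ifact in E. rewrite E. ring.
Qed.

(** The product of the inverse factors [1/(1 + rstep)] is bounded as well, which
    keeps the partial products away from 0. *)
Lemma rGamma_neq_0 s : ~ nonpos_int s -> rGamma s <> 0.
Proof.
  intros Hs.
  destruct (rstep_bound (Cmod s) (Cmod_ge_0 s)) as [K [N0 [HK H0]]].
  destruct (INR_unbounded (2 * K)) as [N1 HN1].
  set (N := max N0 N1).
  assert (H : forall k, (N <= k)%nat -> (Cmod (rstep k s) <= K * tau k)%R).
  { intros k Hk. apply H0; [lra|lia]. }
  assert (Hsmall : forall k, (N <= k)%nat -> (K * tau k <= / 2)%R).
  { intros k Hk. unfold tau.
    assert (INR N1 <= INR k)%R by (apply le_INR; lia).
    pose proof (INR_S_pos k). pose proof (INR_S_pos (S k)).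
    apply Rle_div_l; [now apply Rmult_lt_0_compat|].
    rewrite !S_INR in *. pose proof (pos_INR k). nra. }
  assert (Hne : forall k, (0 < Cmod (rgauss (S k) s))%R).
  { intros k. apply Cmod_gt_0. now apply rgauss_neq_0. }
  assert (B : forall j, (/ Cmod (rgauss (S (N + j)) s) <= / Cmod (rgauss (S N) s) * exp (2 * K))%R).
  { pose proof (product_bound (fun j => / Cmod (rgauss (S (N + j)) s))%R (fun j => (2 * K) * tau (N + j)%nat)%R (2 * K)) as P.
    cbv beta in P. rewrite Nat.add_0_r in P. apply P.
    - left. apply Rinv_0_lt_compat, Hne.
    - intros j. pose proof (tau_pos (N + j)). nra.
    - intros j. rewrite Nat.add_succ_r, rgauss_step, Cmod_mult.
      specialize (H (N + j)%nat ltac:(lia)). specialize (Hsmall (N + j)%nat ltac:(lia)).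
      assert (A : (1 - K * tau (N + j) <= Cmod (1 + rstep (N + j) s))%R).
      { pose proof (Cmod_triangle (1 + rstep (N + j) s) (- rstep (N + j) s)) as T.
        replace (1 + rstep (N + j) s + - rstep (N + j) s) with (RtoC 1) in T by ring.
        rewrite Cmod_1, Cmod_opp in T. lra. }
      pose proof (Hne (N + j)%nat). rewrite Rinv_mult. apply Rmult_le_compat_l; [left; now apply Rinv_0_lt_compat|].
      pose proof (tau_pos (N + j)) as Tp.
      assert (Kt : (0 <= K * tau (N + j))%R) by nra.
      apply (Rmult_le_reg_r (Cmod (1 + rstep (N + j) s))); [lra|].
      rewrite Rinv_l by lra.
      set (kt := (K * tau (N + j))%R) in *.
      replace (2 * K * tau (N + j))%R with (2 * kt)%R by (unfold kt; ring). nra.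
    - intros J. apply tau_shift_sum. lra. }
  intros E.
  pose proof (rgauss_lim s) as L. rewrite E in L.
  set (b := (/ Cmod (rgauss (S N) s) * exp (2 * K))%R) in *.
  assert (Hb : (0 < b)%R).
  { apply Rmult_lt_0_compat; [apply Rinv_0_lt_compat, Hne|apply exp_pos]. }
  destruct (proj1 (Clim_eps eventually _ _) L (/ b)%R (Rinv_0_lt_compat _ Hb)) as [M HM].
  specialize (HM (S (N + M)) ltac:(lia)). specialize (B M). specialize (Hne (N + M)%nat).
  replace (rgauss (S (N + M)) s - 0) with (rgauss (S (N + M)) s) in HM by ring.
  apply Rinv_lt_contravar in HM.
  - rewrite Rinv_inv in HM. lra.
  - apply Rmult_lt_0_compat; [exact Hne|now apply Rinv_0_lt_compat].
Qed.

Lemma CGamma_rGamma s : ~ nonpos_int s -> CGamma s = / rGamma s.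
Proof.
  intros Hs.
  assert (L : filterlim (fun n => INR (fact n) * Rcpow (INR n) s / pochhammer s (S n))
     eventually (locally (/ rGamma s))).
  { apply (filterlim_ext (fun n => / rgauss n s)).
    - intros n. unfold rgauss.
      assert (E : Rcpow (INR n) (- s) = / Rcpow (INR n) s).
      { assert (Q : Rcpow (INR n) (- s) * Rcpow (INR n) s = 1).
        { unfold Rcpow. rewrite <- Cexp_plus. replace (_ + _) with (RtoC 0) by ring. apply Cexp_0. }
        transitivity (Rcpow (INR n) (- s) * Rcpow (INR n) s * / Rcpow (INR n) s); [|rewrite Q; ring].
        field. apply Rcpow_neq_0. }
      rewrite E. unfold ifact. field.
      repeat split; [now apply pochhammer_neq_0|apply Rcpow_neq_0|apply fact_C_neq_0].
    - apply Clim_inv; [typeclasses eauto|now apply rGamma_neq_0|apply rgauss_lim]. }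
  apply Ciota_unique; [|exact L].
  intros y Hy. exact (filterlim_C_unique eventually _ _ _ Hy L).
Qed.

(** * The hypergeometric function divided by Gamma *)

(** [rGamma c / pochhammer c n = rGamma (c + n)] removes the poles in [c]. *)
Definition reg2F1_coef (A B c : C) (n : nat) : C :=
  bcoef A n * (pochhammer (c - B) n * rGamma (c + INR n)).

(** [F(A,c-B;c;v)/Gamma(c)], for every complex [c]. *)
Definition reg2F1 (A B c v : C) : C := psum (reg2F1_coef A B c) v.

Lemma pochhammer_bcoef s n : pochhammer s n = INR (fact n) * bcoef s n.
Proof. unfold bcoef, ifact. field. apply fact_C_neq_0. Qed.

Lemma subexp_falling N : subexp (fun n => INR (fact n) / INR (fact (n - N)))%R.
Proof.
  intros q Hq. destruct (INR_unbounded (q * INR N / (q - 1))) as [N0 HN0].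
  apply (geom_bound _ q (max N N0)); [lra| |].
  - intros n. apply Rmult_le_pos; [apply pos_INR|]. left. apply Rinv_0_lt_compat, INR_fact_lt_0.
  - intros n Hn. replace (S n - N)%nat with (S (n - N)) by lia.
    rewrite !fact_simpl, !mult_INR.
    assert (P1 : (0 < INR (S (n - N)))%R) by (apply lt_0_INR; lia).
    pose proof (INR_fact_neq_0 (n - N)).
    replace (INR (S n) * INR (fact n) / (INR (S (n - N)) * INR (fact (n - N))))%R with
      (INR (S n) / INR (S (n - N)) * (INR (fact n) / INR (fact (n - N))))%R by (field; split; [assumption|lra]).
    apply Rmult_le_compat_r.
    + apply Rmult_le_pos; [apply pos_INR|]. left. apply Rinv_0_lt_compat, INR_fact_lt_0.
    + apply Rle_div_l; [exact P1|]. rewrite !S_INR, minus_INR by lia.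
      assert (INR N0 <= INR n)%R by (apply le_INR; lia).
      assert (Q : (q * INR N / (q - 1) <= INR n)%R) by lra.
      apply Rle_div_l in Q; [|lra]. lra.
Qed.

Lemma pochhammer_ge_fact s k : (forall j, (1 + INR j <= Cmod (s + INR j))%R) ->
  (INR (fact k) <= Cmod (pochhammer s k))%R.
Proof.
  intros H. induction k.
  - simpl. rewrite Cmod_1. lra.
  - rewrite pochhammer_S, Cmod_mult, fact_simpl, mult_INR, S_INR, Rmult_comm.
    specialize (H k). apply Rmult_le_compat; auto using pos_INR. pose proof (pos_INR k); lra. lra.
Qed.

(** For [N] beyond [|c0| + 2] the values of [rGamma] at [c + n] are obtained from
    the one at [c + N] by division by factors of modulus at least [1], [2], and so
    on, so they decay like [1/(n-N)!].  That balances the factorial growth of the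
    Pochhammer symbol of [c - B], uniformly for [c] within distance 1 of [c0]. *)
Lemma reg2F1_coef_majorant A B c0 v : (Cmod v < 1)%R -> exists M N, ex_series M /\
  locally c0 (fun c => forall n, (N <= n)%nat -> (Cmod (reg2F1_coef A B c n * v ^ n) <= M n)%R).
Proof.
  intros Hv. pose proof (Cmod_ge_0 c0) as Hc0. pose proof (Cmod_ge_0 B) as HB0.
  destruct (INR_unbounded (Cmod c0 + 2)) as [N HN].
  set (G := (Cmod (rGamma (c0 + INR N)) + 1)%R).
  set (beta := (Cmod c0 + 1 + Cmod B)%R).
  set (fall := fun n => (INR (fact n) / INR (fact (n - N)))%R).
  exists (fun n => G * ((Cmod (bcoef A n) * Cmod (bcoef beta n) * fall n) * Cmod v ^ n))%R, N.
  assert (Hfall : forall n, (0 <= fall n)%R).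
  { intros n. apply Rmult_le_pos; [apply pos_INR|]. left. apply Rinv_0_lt_compat, INR_fact_lt_0. }
  assert (HAbeta : forall n, (0 <= Cmod (bcoef A n) * Cmod (bcoef beta n))%R).
  { intros n. apply Rmult_le_pos; apply Cmod_ge_0. }
  split.
  - apply (ex_series_scal_l G (fun n => Cmod (bcoef A n) * Cmod (bcoef beta n) * fall n * Cmod v ^ n)%R).
    apply (subexp_series (fun n => Cmod (bcoef A n) * Cmod (bcoef beta n) * fall n)%R).
    + split; [apply Cmod_ge_0|exact Hv].
    + intros n. apply Rmult_le_pos; auto.
    + apply (subexp_mult (fun n => Cmod (bcoef A n) * Cmod (bcoef beta n))%R fall); auto.
      * apply subexp_mult; try (intros; apply Cmod_ge_0); apply subexp_bcoef.
      * apply subexp_falling.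
  - assert (L : filterlim (fun c => rGamma (c + INR N)) (locally c0) (locally (rGamma (c0 + INR N)))).
    { eapply filterlim_comp; [|apply Ccont_rGamma].
      apply Clim_plus; [apply locally_filter|apply Clim_id|apply Clim_const, locally_filter]. }
    pose proof (proj1 (Clim_eps (locally c0) _ _) L 1%R Rlt_0_1) as L1.
    assert (L2 : locally c0 (fun c => (Cmod (c - c0) < 1)%R)).
    { apply Clocally_eps. exists 1%R. split; [lra|auto]. }
    generalize (filter_and _ _ L1 L2). apply filter_imp. intros c [H1 H2] n Hn.
    assert (Hc : (Cmod c <= Cmod c0 + 1)%R).
    { replace c with (c0 + (c - c0)) by ring. eapply Rle_trans; [apply Cmod_triangle|]. lra. }
    assert (HG : (Cmod (rGamma (c + INR N)) <= G)%R).
    { replace (rGamma (c + INR N)) with (rGamma (c0 + INR N) + (rGamma (c + INR N) - rGamma (c0 + INR N))) by ring.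
      eapply Rle_trans; [apply Cmod_triangle|]. unfold G. lra. }
    assert (HP : (INR (fact (n - N)) <= Cmod (pochhammer (c + INR N) (n - N)))%R).
    { apply pochhammer_ge_fact. intros j.
      assert (T : (INR N + INR j <= Cmod (c + INR N + INR j) + Cmod c)%R).
      { rewrite <- (Cmod_opp c).
        rewrite <- (Rabs_pos_eq (INR N + INR j)) by (pose proof (pos_INR N); pose proof (pos_INR j); lra).
        rewrite <- Cmod_R, RtoC_plus.
        replace (RtoC (INR N) + INR j) with ((c + INR N + INR j) + - c) at 1 by ring. apply Cmod_triangle. }
      lra. }
    assert (E : rGamma (c + INR N) = pochhammer (c + INR N) (n - N) * rGamma (c + INR n)).
    { rewrite (rGamma_pochhammer (c + INR N) (n - N)). do 2 f_equal.
      rewrite <- Cplus_assoc, <- RtoC_plus, <- plus_INR. do 3 f_equal. lia. }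
    pose proof (INR_fact_lt_0 (n - N)) as F0.
    assert (HR : (Cmod (rGamma (c + INR n)) <= G * / INR (fact (n - N)))%R).
    { rewrite E, Cmod_mult in HG. apply (Rmult_le_reg_l (INR (fact (n - N)))); [exact F0|].
      replace (INR (fact (n - N)) * (G * / INR (fact (n - N))))%R with G by (field; lra).
      eapply Rle_trans; [|exact HG]. apply Rmult_le_compat_r; [apply Cmod_ge_0|exact HP]. }
    assert (HQ : (Cmod (pochhammer (c - B) n) <= INR (fact n) * Cmod (bcoef beta n))%R).
    { rewrite pochhammer_bcoef, Cmod_mult, Cmod_R, Rabs_pos_eq by apply pos_INR.
      apply Rmult_le_compat_l; [apply pos_INR|]. apply bcoef_le.
      unfold beta, Cminus. eapply Rle_trans; [apply Cmod_triangle|]. rewrite Cmod_opp. lra. }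
    unfold reg2F1_coef. rewrite !Cmod_mult, Cmod_pow.
    assert (Q : (Cmod (pochhammer (c - B) n) * Cmod (rGamma (c + INR n)) <=
       (INR (fact n) * Cmod (bcoef beta n)) * (G * / INR (fact (n - N))))%R).
    { apply Rmult_le_compat; auto using Cmod_ge_0. }
    replace (G * (Cmod (bcoef A n) * Cmod (bcoef beta n) * fall n * Cmod v ^ n))%R with
      (Cmod (bcoef A n) * ((INR (fact n) * Cmod (bcoef beta n)) * (G * / INR (fact (n - N)))) * Cmod v ^ n)%R
      by (unfold fall, Rdiv; ring).
    apply Rmult_le_compat_r; [apply pow_le, Cmod_ge_0|].
    apply Rmult_le_compat_l; [apply Cmod_ge_0|exact Q].
Qed.

Lemma reg2F1_correct A B c v : (Cmod v < 1)%R ->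
  Cseries (fun n => reg2F1_coef A B c n * v ^ n) (reg2F1 A B c v).
Proof.
  intros Hv. destruct (reg2F1_coef_majorant A B c v Hv) as [M [N [H1 H2]]].
  apply (CSum_dominated_from _ M N); [|exact H1].
  apply (locally_singleton c _ H2).
Qed.

Lemma Ccont_reg2F1 A B c v : (Cmod v < 1)%R ->
  filterlim (fun c => reg2F1 A B c v) (locally c) (locally (reg2F1 A B c v)).
Proof.
  intros Hv. destruct (reg2F1_coef_majorant A B c v Hv) as [M [N [H1 H2]]].
  apply (tannery (locally c) (fun c n => reg2F1_coef A B c n * v ^ n) (fun c => reg2F1 A B c v)
    (fun n => reg2F1_coef A B c n * v ^ n) _ M N).
  - intros n.
    apply Clim_mult; [apply locally_filter| |apply Clim_const, locally_filter].
    apply Clim_mult; [apply locally_filter|apply Clim_const, locally_filter|].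
    apply Clim_mult; [apply locally_filter| |].
    + apply (filterlim_comp _ _ _ (fun x => x + - B) (fun y => pochhammer y n) _ (locally (c + - B)));
        [|apply Ccont_pochhammer].
      apply Clim_plus; [apply locally_filter|apply Clim_id|apply Clim_const, locally_filter].
    + apply (filterlim_comp _ _ _ (fun x => x + INR n) rGamma _ (locally (c + INR n)));
        [|apply Ccont_rGamma].
      apply Clim_plus; [apply locally_filter|apply Clim_id|apply Clim_const, locally_filter].
  - exact H1.
  - exact H2.
  - apply filter_forall. intros x. now apply reg2F1_correct.
  - now apply reg2F1_correct.
Qed.

Lemma reg2F1_psum A B c v : ~ nonpos_int c -> (Cmod v < 1)%R ->
  reg2F1 A B c v = rGamma c * psum (hyp2F1_coef A (c - B) c) v.
Proof.
  intros Hc Hv. apply (Cseries_unique _ _ _ (reg2F1_correct A B c v Hv)).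
  eapply Cseries_ext; [|apply Cseries_scal, subexp_psum; [apply subexp_hyp, Hc|exact Hv]].
  intros n. simpl. rewrite hyp2F1_coef_bcoef by exact Hc. unfold reg2F1_coef.
  rewrite (rGamma_pochhammer c n). field. now apply pochhammer_neq_0.
Qed.

Lemma hyp2F1_over_Gamma_generic A B c w : ~ nonpos_int c -> (Re w < / 2)%R ->
  hyp2F1 A B c w / CGamma c = binom (- A) (w / (w - 1)) * reg2F1 A B c (w / (w - 1)).
Proof.
  intros Hc Hw. rewrite hyp2F1_pfaff, CGamma_rGamma, reg2F1_psum; auto.
  - field. now apply rGamma_neq_0.
  - apply Cmod_pfaff_lt, Hw.
Qed.

Lemma nonpos_int_isolated c : nonpos_int c -> locally' c (fun c' => ~ nonpos_int c').
Proof.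
  intros [m ->]. apply Clocally_eps. exists 1%R. split; [lra|].
  intros y Hy Hne [k ->]. apply Hne. f_equal. f_equal.
  replace (- RtoC (INR k) - - RtoC (INR m)) with (RtoC (INR m - INR k)) in Hy by (rewrite RtoC_minus; ring).
  rewrite Cmod_R in Hy. apply Rabs_lt_between in Hy.
  f_equal. assert (INR m < INR (S k))%R as A1 by (rewrite S_INR; lra).
  assert (INR k < INR (S m))%R as A2 by (rewrite S_INR; lra).
  apply INR_lt in A1. apply INR_lt in A2. lia.
Qed.

(** At a nonpositive integer [c] the punctured limit of the generic formula is its
    value at [c], by continuity of [reg2F1]. *)
Lemma hyp2F1_over_Gamma_pfaff A B c w : (Re w < / 2)%R ->
  hyp2F1_over_Gamma A B c w = binom (- A) (w / (w - 1)) * reg2F1 A B c (w / (w - 1)).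
Proof.
  intros Hw. unfold hyp2F1_over_Gamma.
  destruct (excluded_middle_informative (nonpos_int c)) as [Hc|Hc].
  - assert (L : filterlim (fun c' => hyp2F1 A B c' w / CGamma c') (locally' c)
      (locally (binom (- A) (w / (w - 1)) * reg2F1 A B c (w / (w - 1))))).
    { apply (filterlim_ext_loc (fun c' => binom (- A) (w / (w - 1)) * reg2F1 A B c' (w / (w - 1)))).
      - generalize (nonpos_int_isolated c Hc). apply filter_imp. intros c' Hc'.
        symmetry. now apply hyp2F1_over_Gamma_generic.
      - apply Clim_mult; [apply locally'_filter|apply Clim_const, locally'_filter|].
        intros P HP.
        pose proof (Ccont_reg2F1 A B c _ (proj2 (Cmod_pfaff_lt w Hw)) P HP) as X.
        unfold filtermap in X. revert X. apply (filter_imp (F := locally c)). intros y Y _. exact Y. }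
    apply Ciota_unique; [|exact L].
    intros y Hy. rewrite <- (is_C_lim_unique _ _ _ Hy). apply is_C_lim_unique. exact L.
  - now apply hyp2F1_over_Gamma_generic.
Qed.

Lemma Cseries_mul_var (g : nat -> C) (v l : C) : Cseries (fun n => g n * v ^ n) l ->
  Cseries (fun n => match n with O => 0 | S m => g m end * v ^ n) (v * l).
Proof.
  intros H. apply Cseries_cons. simpl.
  replace (v * l - 0 * 1) with (v * l) by ring.
  apply (Cseries_ext (fun n => v * (g n * v ^ n))); [intros; ring|]. now apply Cseries_scal.
Qed.

(** Gauss's relation for [F(A,B;c;w)/Gamma(c)] with [c] varying, in the variable
    [v = w/(w-1)].  It holds separately for each power of [v]: after dividing out the
    common Pochhammer symbols, it is a polynomial identity. *)
Lemma reg2F1_contiguous A B c v : (Cmod v < 1)%R ->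
  reg2F1 A B (c - 1) v + v * ((c - A) * (c - B) * reg2F1 A B (c + 1) v) =
  ((c - 1) * (1 - v) + (2 * c - A - B - 1) * v) * reg2F1 A B c v.
Proof.
  intros Hv.
  pose proof (reg2F1_correct A B (c - 1) v Hv) as S1.
  pose proof (reg2F1_correct A B c v Hv) as S2.
  pose proof (reg2F1_correct A B (c + 1) v Hv) as S3.
  pose proof (Cseries_mul_var _ _ _ S2) as S2'.
  pose proof (Cseries_mul_var _ _ _ S3) as S3'.
  assert (Q : Cseries (fun _ => RtoC 0)
    ((reg2F1 A B (c - 1) v - (c - 1) * reg2F1 A B c v) +
     ((c - A) * (c - B) * (v * reg2F1 A B (c + 1) v) + (A + B - c) * (v * reg2F1 A B c v)))).
  { eapply Cseries_ext; [|apply Cseries_plus; [apply Cseries_minus; [exact S1|apply Cseries_scal; exact S2]|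
      apply Cseries_plus; [apply Cseries_scal; exact S3'|apply Cseries_scal; exact S2']]].
    intros n. cbv beta.
    destruct n as [|m].
    - unfold reg2F1_coef. rewrite !bcoef_0. simpl.
      replace (c - 1 + 0) with (c - 1) by ring. rewrite (rGamma_shift (c - 1)).
      replace (c - 1 + 1) with (c + 0) by ring. ring.
    - match goal with |- ?L = _ => transitivity (RtoC 0 * v ^ S m); [|ring] end.
      assert (K : reg2F1_coef A B (c - 1) (S m) - (c - 1) * reg2F1_coef A B c (S m) +
        ((c - A) * (c - B) * reg2F1_coef A B (c + 1) m + (A + B - c) * reg2F1_coef A B c m) = 0).
      { unfold reg2F1_coef. unfold bcoef. rewrite <- (ifact_S m).
        assert (E1 : pochhammer (c - 1 - B) (S m) = (c - 1 - B) * pochhammer (c - B) m).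
        { rewrite pochhammer_first. do 2 f_equal. ring. }
        assert (E2 : (c - B) * pochhammer (c + 1 - B) m = pochhammer (c - B) m * (c - B + INR m)).
        { rewrite <- pochhammer_S, pochhammer_first. do 2 f_equal. ring. }
        rewrite E1, !pochhammer_S, INR_S_C.
        replace (c - 1 + (INR m + 1)) with (c + INR m) by ring.
        rewrite (rGamma_shift (c + INR m)).
        replace (c + (INR m + 1)) with (c + INR m + 1) by ring.
        replace (c + 1 + INR m) with (c + INR m + 1) by ring.
        set (g := rGamma (c + INR m + 1)). set (p := pochhammer A m). set (q := pochhammer (c - B) m) in *.
        set (i := ifact (S m)).
        replace ((c - A) * (c - B) * (p * ((INR m + 1) * i) * (pochhammer (c + 1 - B) m * g))) with
         ((c - A) * (p * ((INR m + 1) * i) * (((c - B) * pochhammer (c + 1 - B) m) * g))) by ring.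
        rewrite E2. ring. }
      rewrite <- K. ring. }
  pose proof (Cseries_unique _ _ _ Q (Cseries_single (fun _ => RtoC 0) ltac:(auto))) as E.
  apply Ceq_minus. rewrite <- E. ring.
Qed.

Lemma inv_INR_lim_shift j : filterlim (fun k => RtoC (/ INR (S k + j))) eventually (locally (RtoC 0)).
Proof.
  apply Clim_eps; [apply eventually_filter|]. intros e He.
  destruct (proj1 (Clim_eps eventually _ _) inv_INR_lim e He) as [N HN].
  exists N. intros n Hn. apply HN. lia.
Qed.

Lemma INR_S_not_nonpos k : ~ nonpos_int (INR (S k)).
Proof.
  intros [n E]. rewrite <- RtoC_opp in E. apply RtoC_inj in E. pose proof (pos_INR n).
  pose proof (INR_S_pos k). lra.
Qed.

(** A bound independent of [k], for dominated convergence as the third parameter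
    tends to infinity. *)
Lemma pochhammer_ratio_le B k n :
  (Cmod (pochhammer (INR (S k) - B) n / pochhammer (INR (S k)) n) <=
   Cmod (pochhammer (1 + Cmod B)%R n / pochhammer 1 n))%R.
Proof.
  pose proof (Cmod_ge_0 B) as HB. induction n.
  - simpl. lra.
  - rewrite !pochhammer_S.
    assert (N1 : forall c, ~ nonpos_int c -> c + INR n <> 0) by (intros; now apply nonpos_int_add_neq_0).
    assert (St : forall a c, ~ nonpos_int c ->
      pochhammer a n * (a + INR n) / (pochhammer c n * (c + INR n)) =
      pochhammer a n / pochhammer c n * ((a + INR n) / (c + INR n))).
    { intros a c Hc. field. split; [now apply N1|now apply pochhammer_neq_0]. }
    rewrite !St by (apply INR_S_not_nonpos || apply one_not_nonpos).
    rewrite (Cmod_mult (_ / _)), (Cmod_mult (pochhammer (1 + Cmod B)%R n / pochhammer 1 n)).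
    apply Rmult_le_compat; try apply Cmod_ge_0; [exact IHn|].
    pose proof (pos_INR n) as Hn. pose proof (INR_S_pos k) as Hk.
    assert (Hk1 : (1 <= INR (S k))%R) by (rewrite S_INR; pose proof (pos_INR k); lra).
    rewrite !Cmod_div by (apply N1; apply INR_S_not_nonpos || apply one_not_nonpos).
    rewrite <- !RtoC_plus, (Cmod_R (INR (S k) + INR n)), (Cmod_R (1 + Cmod B + INR n)), (Cmod_R (1 + INR n)).
    rewrite !Rabs_pos_eq by lra.
    apply Rle_div_l; [lra|].
    apply (Rle_trans _ (INR (S k) + INR n + Cmod B)).
    + replace (INR (S k) - B + INR n) with (RtoC (INR (S k) + INR n) + - B) by (rewrite RtoC_plus; ring).
      eapply Rle_trans; [apply Cmod_triangle|]. rewrite Cmod_opp, Cmod_R, Rabs_pos_eq; lra.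
    + replace ((1 + Cmod B + INR n) / (1 + INR n))%R with (1 + Cmod B / (1 + INR n))%R by (field; lra).
      assert (0 <= Cmod B / (1 + INR n))%R by (apply Rmult_le_pos; [exact HB|left; apply Rinv_0_lt_compat; lra]).
      assert (Cmod B / (1 + INR n) * (1 + INR n) = Cmod B)%R by (field; lra). nra.
Qed.

Lemma pochhammer_ratio_lim B n :
  filterlim (fun k => pochhammer (INR (S k) - B) n / pochhammer (INR (S k)) n) eventually (locally (RtoC 1)).
Proof.
  induction n.
  - apply (filterlim_ext (fun _ => RtoC 1)); [intros; simpl; field|apply Clim_const; typeclasses eauto].
  - apply (filterlim_ext (fun k => pochhammer (INR (S k) - B) n / pochhammer (INR (S k)) n *
      (1 + - B * RtoC (/ INR (S k + n))))).
    + intros k. rewrite !pochhammer_S.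
      assert (N1 : RtoC (INR (S k)) + INR n <> 0).
      { rewrite <- RtoC_plus. intros E. apply RtoC_inj in E. pose proof (INR_S_pos k). pose proof (pos_INR n). lra. }
      rewrite RtoC_inv by (apply not_0_INR; lia). rewrite plus_INR, RtoC_plus. field.
      split; [exact N1|]. apply pochhammer_neq_0, INR_S_not_nonpos.
    + apply (Clim_val _ _ (1 * (1 + - B * 0))); [ring|].
      apply Clim_mult; [typeclasses eauto|exact IHn|].
      apply Clim_plus; [typeclasses eauto|apply Clim_const; typeclasses eauto|].
      apply Clim_mult; [typeclasses eauto|apply Clim_const; typeclasses eauto|apply inv_INR_lim_shift].
Qed.

(** [F(A,c-B;c;v)] tends to [(1-v)^(-A)], which is not 0, as [c] tends to infinity
    through the integers. *)
Lemma reg2F1_neq_0 A B v : (Cmod v < 1)%R -> exists k, reg2F1 A B (INR (S k)) v <> 0.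
Proof.
  intros Hv.
  assert (L : filterlim (fun k => psum (hyp2F1_coef A (INR (S k) - B) (INR (S k))) v) eventually
     (locally (binom A v))).
  { apply (tannery eventually (fun k n => hyp2F1_coef A (INR (S k) - B) (INR (S k)) n * v ^ n) _
      (fun n => bcoef A n * v ^ n) _
      (fun n => Cmod (hyp2F1_coef A (1 + Cmod B)%R 1 n) * Cmod v ^ n)%R 0).
    - intros n.
      apply (filterlim_ext (fun k => bcoef A n * (pochhammer (INR (S k) - B) n / pochhammer (INR (S k)) n) * v ^ n)).
      { intros k. now rewrite hyp2F1_coef_bcoef by apply INR_S_not_nonpos. }
      apply Clim_mult; [typeclasses eauto| |apply Clim_const; typeclasses eauto].
      apply (Clim_val _ _ (bcoef A n * 1)); [ring|].
      apply Clim_mult; [typeclasses eauto|apply Clim_const; typeclasses eauto|apply pochhammer_ratio_lim].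
    - apply (subexp_series (fun n => Cmod (hyp2F1_coef A (1 + Cmod B)%R 1 n))).
      + split; [apply Cmod_ge_0|exact Hv].
      + intros; apply Cmod_ge_0.
      + apply subexp_hyp, one_not_nonpos.
    - exists 0%nat. intros k _ n _. rewrite Cmod_coef.
      apply Rmult_le_compat_r; [apply pow_le, Cmod_ge_0|].
      rewrite !hyp2F1_coef_bcoef by (apply INR_S_not_nonpos || apply one_not_nonpos).
      rewrite (Cmod_mult (bcoef A n)), (Cmod_mult (bcoef A n)).
      apply Rmult_le_compat_l; [apply Cmod_ge_0|]. apply pochhammer_ratio_le.
    - exists 0%nat. intros k _. apply subexp_psum; [apply subexp_hyp, INR_S_not_nonpos|exact Hv].
    - now apply binom_correct. }
  pose proof (proj1 (Cmod_gt_0 _) (binom_neq_0 A v Hv)) as P.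
  destruct (proj1 (Clim_eps eventually _ _) L _ P) as [N HN].
  exists N. rewrite reg2F1_psum by (apply INR_S_not_nonpos || exact Hv).
  apply Cmult_neq_0; [apply rGamma_neq_0, INR_S_not_nonpos|].
  intros E. specialize (HN N (le_n N)). rewrite E in HN.
  replace (0 - binom A v) with (- binom A v) in HN by ring. rewrite Cmod_opp in HN. lra.
Qed.

(** * The eigenvalue equation *)

Lemma Csqrt_pos (r : R) : (0 <= r)%R -> Csqrt r = RtoC (sqrt r).
Proof.
  intros H. unfold Csqrt. rewrite Cmod_R, Rabs_pos_eq, re_RtoC, im_RtoC by exact H.
  destruct (Rlt_dec 0 0) as [L|L]; [lra|].
  replace ((r + r) / 2)%R with r by field. replace ((r - r) / 2)%R with 0%R by field.
  now rewrite sqrt_0.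
Qed.

Lemma CGamma_shift s : ~ nonpos_int s -> CGamma (s + 1) = s * CGamma s.
Proof.
  intros Hs. pose proof (nonpos_int_add s 1 Hs) as Hs1. simpl in Hs1.
  rewrite !CGamma_rGamma, (rGamma_shift s) by assumption.
  field. split; [now apply rGamma_neq_0|]. intros E. apply Hs. exists 0%nat. rewrite E. simpl. ring.
Qed.

Lemma CGamma_neq_0 s : ~ nonpos_int s -> CGamma s <> 0.
Proof.
  intros Hs E. rewrite CGamma_rGamma in E by exact Hs. apply C1_nz.
  rewrite <- (Cinv_r (rGamma s)), E by now apply rGamma_neq_0. ring.
Qed.

(** In the principal series the product is the squared modulus of [z + n]; in the
    complementary series no integer separates [-z] from [-z'], so both factors have
    the same sign. *)
Lemma series_product_pos z z' : principal_series z z' \/ complementary_series z z' ->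
  forall n : Z, exists r : R, (0 < r)%R /\ (z + IZR n) * (z' + IZR n) = RtoC r.
Proof.
  intros H n. destruct z as [x y], z' as [x' y'].
  exists (fst (((x, y) + IZR n) * ((x', y') + IZR n))).
  destruct H as [[H1 [H2 H3]]|[H1 [H2 [m [H3 H4]]]]]; simpl in *.
  - unfold Cconj in H3. simpl in H3. injection H3 as -> ->. split.
    + assert (0 < y * y)%R by nra. pose proof (Rle_0_sqr (x + IZR n)) as Q. unfold Rsqr in Q. lra.
    + unfold Cmult, RtoC. simpl. f_equal. ring.
  - subst y y'. rewrite plus_IZR in H3, H4. split.
    + rewrite Rplus_0_l, Rmult_0_l, Rminus_0_r.
      destruct (Z_lt_le_dec (m + n) 0) as [L|L].
      * assert (IZR (m + n) <= -1)%R by (apply IZR_le; lia). rewrite plus_IZR in H. nra.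
      * apply IZR_le in L. rewrite plus_IZR in L. apply Rmult_lt_0_compat; lra.
    + unfold Cmult, RtoC. simpl. f_equal; ring.
Qed.

Lemma shifted_not_nonpos z : (forall n : Z, z + IZR n <> 0) -> forall n : Z, ~ nonpos_int (z + IZR n).
Proof.
  intros H n [m E]. apply (H (n + Z.of_nat m)%Z).
  rewrite plus_IZR, <- INR_IZR_INZ, RtoC_plus, Cplus_assoc, E. ring.
Qed.

Lemma RtoC_half : RtoC (/ 2)%R = / 2.
Proof. apply RtoC_inv. lra. Qed.

Section Eigen.
Variables (z z' : C) (xi : R) (a : half_int).
Hypothesis Hxi : (0 < xi < 1)%R.
Hypothesis Hz : forall n : Z, exists r : R, (0 < r)%R /\ (z + IZR n) * (z' + IZR n) = RtoC r.

Lemma z_int_neq n : z + IZR n <> 0.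
Proof.
  intros E. destruct (Hz n) as [r [Hr H]]. rewrite E, Cmult_0_l in H. apply RtoC_inj in H. lra.
Qed.

Lemma z'_int_neq n : z' + IZR n <> 0.
Proof.
  intros E. destruct (Hz n) as [r [Hr H]]. rewrite E, Cmult_0_r in H. apply RtoC_inj in H. lra.
Qed.

Definition Gamma_pair (n : Z) : C := CGamma (z + IZR n) * CGamma (z' + IZR n).

Lemma Gamma_pair_succ n : Gamma_pair (n + 1) = (z + IZR n) * (z' + IZR n) * Gamma_pair n.
Proof.
  unfold Gamma_pair. rewrite plus_IZR, RtoC_plus, !Cplus_assoc.
  rewrite !CGamma_shift by (apply shifted_not_nonpos; apply z_int_neq || apply z'_int_neq). ring.
Qed.

Lemma Gamma_pair_neq_0 n : Gamma_pair n <> 0.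
Proof.
  apply Cmult_neq_0; apply CGamma_neq_0, shifted_not_nonpos; apply z_int_neq || apply z'_int_neq.
Qed.

(** By the functional equation, the quotient is a product of positive weights or the
    inverse of one. *)
Lemma Gamma_pair_ratio m n : exists r : R, (0 < r)%R /\ Gamma_pair n / Gamma_pair m = RtoC r.
Proof.
  replace n with (m + (n - m))%Z by lia. generalize (n - m)%Z. clear n.
  apply Z.bi_induction.
  - intros x y ->. reflexivity.
  - exists 1%R. split; [lra|]. rewrite Z.add_0_r. field. apply Gamma_pair_neq_0.
  - intros k. rewrite Z.add_succ_r, <- Z.add_1_r, Gamma_pair_succ.
    destruct (Hz (m + k)) as [q [Hq E]]. rewrite E.
    split; intros [r [Hr Er]].
    + exists (q * r)%R. split; [now apply Rmult_lt_0_compat|].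
      rewrite RtoC_mult, <- Er. field. apply Gamma_pair_neq_0.
    + exists (r / q)%R. split; [now apply Rdiv_lt_0_compat|].
      rewrite RtoC_div by lra. rewrite <- Er. field.
      split; [apply Gamma_pair_neq_0|]. intros Z0. apply RtoC_inj in Z0. lra.
Qed.

(** The quantity under the square root in [psi]. *)
Definition psi_radicand (x : half_int) : C :=
  CGamma (x + z + / 2) * CGamma (x + z' + / 2) / (CGamma (z - a + / 2) * CGamma (z' - a + / 2)).

Lemma psi_radicand_gpair x : psi_radicand x = Gamma_pair (hfloor x + 1) / Gamma_pair (- hfloor a).
Proof.
  assert (E : / 2 + / 2 = 1) by field.
  assert (A1 : forall s : C, x + s + / 2 = s + IZR (hfloor x + 1)).
  { intros s. unfold hval. rewrite plus_IZR, !RtoC_plus, RtoC_half, <- E. ring. }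
  assert (A2 : forall s : C, s - a + / 2 = s + IZR (- hfloor a)).
  { intros s. unfold hval. rewrite opp_IZR, RtoC_opp, RtoC_plus, RtoC_half. ring. }
  unfold psi_radicand, Gamma_pair. now rewrite !A1, !A2.
Qed.

Lemma psi_radicand_hsucc x :
  psi_radicand (hsucc x) = (z + x + / 2) * (z' + x + / 2) * psi_radicand x.
Proof.
  rewrite !psi_radicand_gpair. simpl hfloor. rewrite Gamma_pair_succ.
  unfold hval. rewrite !plus_IZR, !RtoC_plus, RtoC_half. field. apply Gamma_pair_neq_0.
Qed.

Lemma hsucc_hpred x : hsucc (hpred x) = x.
Proof. destruct x as [n]. unfold hsucc, hpred. simpl. f_equal. lia. Qed.

Lemma psi_radicand_pos x : exists r : R, (0 < r)%R /\ psi_radicand x = RtoC r.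
Proof. rewrite psi_radicand_gpair. apply Gamma_pair_ratio. Qed.

Lemma weight_pos (x : half_int) : exists r : R, (0 < r)%R /\ (z + x + / 2) * (z' + x + / 2) = RtoC r.
Proof.
  destruct (Hz (hfloor x + 1)) as [r [Hr E]]. exists r. split; [exact Hr|].
  rewrite <- E. unfold hval. rewrite plus_IZR, !RtoC_plus, RtoC_half. field.
Qed.

(** The factor of [psi] that does not depend on [x]; the binomial series is the
    power [(1-w)^(-A)] of Pfaff's transformation. *)
Definition psi_const : C := Rcpow (1 - xi) (/ 2 * (z + z') - a) * binom (- (- z + a + / 2)) xi.

Definition psi_hyp (x : half_int) : C := reg2F1 (- z + a + / 2) (- z' + a + / 2) (x + a + 1) xi.

Lemma xi_neq : RtoC xi - 1 <> 0.
Proof. rewrite <- RtoC_minus. intros E. apply RtoC_inj in E. lra. Qed.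

Lemma Cmod_xi : (Cmod xi < 1)%R.
Proof. rewrite Cmod_R, Rabs_pos_eq; lra. Qed.

Lemma psi_reg2F1 x : psi z z' xi a x =
  Csqrt (psi_radicand x) * Rcpow xi (/ 2 * (x + a)) * (psi_const * psi_hyp x).
Proof.
  unfold psi. fold (psi_radicand x). pose proof xi_neq as N.
  assert (Hw : (Re (xi / (xi - 1)) < / 2)%R).
  { rewrite <- RtoC_minus, <- RtoC_div, re_RtoC by lra.
    apply Rlt_trans with 0%R; [|lra].
    replace (xi / (xi - 1))%R with (- (xi / (1 - xi)))%R by (field; lra).
    apply Ropp_lt_gt_0_contravar. apply Rdiv_lt_0_compat; lra. }
  rewrite hyp2F1_over_Gamma_pfaff by exact Hw.
  assert (Ew : xi / (xi - 1) / (xi / (xi - 1) - 1) = xi).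
  { replace (xi / (xi - 1) - 1) with (/ (xi - 1)) by (field; exact N). field. exact N. }
  rewrite Ew. unfold psi_const, psi_hyp. ring.
Qed.

Lemma psi_const_neq_0 : psi_const <> 0.
Proof. apply Cmult_neq_0; [apply Rcpow_neq_0|apply binom_neq_0, Cmod_xi]. Qed.

Lemma Rcpow_plus r s t : Rcpow r (s + t) = Rcpow r s * Rcpow r t.
Proof. unfold Rcpow. rewrite <- Cexp_plus. f_equal. ring. Qed.

Lemma Rcpow_half r : (0 < r)%R -> Rcpow r (/ 2) = RtoC (sqrt r).
Proof.
  intros Hr. unfold Rcpow. rewrite <- RtoC_half, <- RtoC_mult, Cexp_real. f_equal.
  rewrite <- (Rpower_sqrt r Hr). reflexivity.
Qed.

Lemma hval_hsucc x : RtoC (hval (hsucc x)) = x + 1.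
Proof. unfold hval, hsucc. simpl hfloor. rewrite plus_IZR, !RtoC_plus. ring. Qed.

Lemma hval_hpred x : RtoC (hval (hpred x)) = x - 1.
Proof. rewrite <- (hsucc_hpred x) at 2. rewrite hval_hsucc. ring. Qed.

Lemma Rcpow_hsucc x : Rcpow xi (/ 2 * (hsucc x + a)) = Rcpow xi (/ 2 * (x + a)) * RtoC (sqrt xi).
Proof.
  rewrite hval_hsucc, <- (Rcpow_half xi), <- Rcpow_plus by lra. f_equal. ring.
Qed.

Lemma psi_hyp_contiguous x :
  psi_hyp (hpred x) + xi * ((z + x + / 2) * (z' + x + / 2)) * psi_hyp (hsucc x) =
  ((x + a) * (1 - xi) + (2 * x + z + z') * xi) * psi_hyp x.
Proof.
  unfold psi_hyp. rewrite hval_hsucc, hval_hpred.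
  pose proof (reg2F1_contiguous (- z + a + / 2) (- z' + a + / 2) (x + a + 1) xi Cmod_xi) as H.
  replace (x - 1 + a + 1) with (x + a + 1 - 1) by ring.
  replace (x + 1 + a + 1) with (x + a + 1 + 1) by ring.
  assert (E : / 2 + / 2 = 1) by field.
  replace (x + a + 1 - (- z + a + / 2)) with (z + x + / 2) in H
    by (transitivity (z + x + (/ 2 + / 2) - / 2); [ring|rewrite E; ring]).
  replace (x + a + 1 - (- z' + a + / 2)) with (z' + x + / 2) in H
    by (transitivity (z' + x + (/ 2 + / 2) - / 2); [ring|rewrite E; ring]).
  replace (2 * (x + a + 1) - (- z + a + / 2) - (- z' + a + / 2) - 1) with (2 * x + z + z') in H
    by (transitivity (2 * x + z + z' + 1 - (/ 2 + / 2)); [rewrite E; ring|ring]).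
  replace (x + a + 1 - 1) with (x + a) in H |- * by ring.
  rewrite <- H. ring.
Qed.

Lemma psi_eigen x : D_op z z' xi (psi z z' xi a) x = a * (1 - xi) * psi z z' xi a x.
Proof.
  unfold D_op. rewrite !psi_reg2F1.
  destruct (psi_radicand_pos x) as [r [Hr Er]].
  destruct (weight_pos x) as [q1 [Hq1 E1]].
  destruct (weight_pos (hpred x)) as [q0 [Hq0 E0]].
  assert (Es : psi_radicand (hsucc x) = RtoC (q1 * r)).
  { now rewrite psi_radicand_hsucc, E1, Er, RtoC_mult. }
  assert (Ep : psi_radicand (hpred x) = RtoC (r / q0)).
  { pose proof (psi_radicand_hsucc (hpred x)) as H. rewrite hsucc_hpred, E0, Er in H.
    rewrite RtoC_div, H by lra. field. intros Z0. apply RtoC_inj in Z0. lra. }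
  assert (P1 : (0 <= q1 * r)%R) by (left; now apply Rmult_lt_0_compat).
  assert (P0 : (0 <= r / q0)%R) by (left; now apply Rdiv_lt_0_compat).
  assert (C1 : xi * (z + x + / 2) * (z' + x + / 2) = RtoC (xi * q1)).
  { rewrite RtoC_mult, <- E1. ring. }
  assert (C0 : xi * (z + x - / 2) * (z' + x - / 2) = RtoC (xi * q0)).
  { rewrite RtoC_mult, <- E0, hval_hpred. field. }
  rewrite C1, C0, Es, Ep, Er.
  rewrite !Csqrt_pos by (try assumption; try (left; apply Rmult_lt_0_compat); lra).
  rewrite sqrt_div_alt by lra. rewrite !sqrt_mult by lra.
  assert (Nq0 : (sqrt q0 <> 0)%R) by (apply Rgt_not_eq, sqrt_lt_R0; lra).
  assert (Nxi : (sqrt xi <> 0)%R) by (apply Rgt_not_eq, sqrt_lt_R0; lra).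
  rewrite RtoC_div by exact Nq0. rewrite !RtoC_mult.
  assert (X1 : RtoC (sqrt q1) * RtoC (sqrt q1) = RtoC q1) by (rewrite <- RtoC_mult, sqrt_sqrt; [reflexivity|lra]).
  assert (Xx : RtoC (sqrt xi) * RtoC (sqrt xi) = RtoC xi) by (rewrite <- RtoC_mult, sqrt_sqrt; [reflexivity|lra]).
  assert (Nq0' : RtoC (sqrt q0) <> 0) by (intros Z0; apply RtoC_inj in Z0; contradiction).
  assert (Nxi' : RtoC (sqrt xi) <> 0) by (intros Z0; apply RtoC_inj in Z0; contradiction).
  pose proof (Rcpow_hsucc (hpred x)) as Rp. rewrite hsucc_hpred in Rp.
  rewrite Rcpow_hsucc, Rp.
  pose proof (psi_hyp_contiguous x) as K. rewrite E1 in K.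
  set (sx := RtoC (sqrt xi)) in *. set (s1 := RtoC (sqrt q1)) in *.
  set (s0 := RtoC (sqrt q0)) in *. set (sr := RtoC (sqrt r)).
  set (e := Rcpow xi (/ 2 * (hpred x + a))).
  (* The root of the coefficient and the root in the step of [psi] combine to a
     square at [x+1] and cancel at [x-1]. *)
  transitivity (sr * (e * sx) * psi_const *
    (psi_hyp (hpred x) + (sx * sx) * (s1 * s1) * psi_hyp (hsucc x) - (x + xi * (z + z' + x)) * psi_hyp x)).
  - field. exact Nq0'.
  - rewrite Xx, X1, K. ring.
Qed.

Lemma psi_nonzero : exists x, psi z z' xi a x <> 0.
Proof.
  destruct (reg2F1_neq_0 (- z + a + / 2) (- z' + a + / 2) xi Cmod_xi) as [k Hk].
  (* This [x] makes the third parameter [x + a + 1] equal to [k + 1]. *)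
  exists (Half (Z.of_nat (S k) - hfloor a - 2)).
  rewrite psi_reg2F1. set (x := Half _).
  assert (E : x + a + 1 = INR (S k)).
  { unfold x, hval. rewrite INR_IZR_INZ. generalize (Z.of_nat (S k)). intros m.
    cbn [hfloor]. rewrite !minus_IZR, <- !RtoC_plus. f_equal. field. }
  destruct (psi_radicand_pos x) as [r [Hr Er]]. rewrite Er, Csqrt_pos by lra.
  apply Cmult_neq_0; [apply Cmult_neq_0; [|apply Rcpow_neq_0]|apply Cmult_neq_0; [apply psi_const_neq_0|]].
  - intros Z0. apply RtoC_inj in Z0. pose proof (sqrt_lt_R0 r Hr). lra.
  - unfold psi_hyp. rewrite E. exact Hk.
Qed.
End Eigen.

Theorem proposition2p1 :
  forall (z z' : C) (xi : R),
    (0 < xi < 1)%R ->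
    principal_series z z' \/ complementary_series z z' ->
    forall a : half_int,
      eigenfunction (D_op z z' xi) (a * (1 - xi)) (psi z z' xi a).
Proof.
  intros z z' xi Hxi Hz a. pose proof (series_product_pos z z' Hz) as Hp. split.
  - now apply psi_nonzero.
  - intros x. now apply psi_eigen.
Qed.
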